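(* Let $f(u,v)=au^2+buv+cv^2$ (with $a,b,c\in\mathbb{Z}$) be a reduced positive definite binary quadratic form of discriminant $-D$, and let $\ell\geq 1$ be a squarefree integer. Then, for all real $x\geq D^2$, $$\sum_{\substack{1\leq n\leq x\\ \ell\mid n}} r_f(n)=\frac{2\pi}{\sqrt{D}}\,g(\ell)\,x+O\left(\frac{\tau(\ell)\,\ell}{D^{1/6}}\,x^{1/3}+\frac{\tau(\ell)\,\ell^{5/2}D^{3/4}}{a^{7/4}}\,x^{1/4}\right),$$ where $g$ is the multiplicative function determined by $g(p)=\frac{1}{p}\left(1+\chi(p)-\frac{\chi(p)}{p}\right)$ for all primes $p$, $\chi=\left(\frac{-D}{\cdot}\right)$ is the Kronecker symbol, $\tau$ is the divisor function, and the implied constant is absolute.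
   Context: For a binary quadratic form $f(u,v)=au^2+buv+cv^2$ with integer coefficients, its discriminant is $-D=b^2-4ac$; $f$ is positive definite if $D>0$ (and $a>0$), and primitive if $\gcd(a,b,c)=1$. A primitive positive definite form is reduced if $|b|\leq a\leq c$ and, whenever $|b|=a$ or $a=c$, also $b\geq 0$. For an integer $n\geq 0$, $r_f(n)=\#\{(u,v)\in\mathbb{Z}^2: f(u,v)=n\}$. *)

(* Defs.v *)
From mathcomp Require Import all_boot all_order all_algebra finmap.
From mathcomp Require Import all_classical all_reals all_analysis.
Set Implicit Arguments. Unset Strict Implicit. Unset Printing Implicit Defensive.
Import Order.TTheory GRing.Theory Num.Theory.
Local Open Scope ring_scope.

(* The form a u^2 + b u v + c v^2. *)
Record bqf := Bqf { qa : int; qb : int; qc : int }.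

Definition qeval (f : bqf) (u v : int) : int :=
  qa f * u ^+ 2 + qb f * u * v + qc f * v ^+ 2.

Definition disc (f : bqf) : int := qb f ^+ 2 - 4 * qa f * qc f.

Definition posdef (f : bqf) : Prop := disc f < 0 /\ 0 < qa f.

Definition primitive (f : bqf) : Prop := gcdz (gcdz (qa f) (qb f)) (qc f) = 1.

Definition reduced (f : bqf) : Prop :=
  [/\ primitive f, posdef f, `|qb f| <= qa f <= qc f
    & (`|qb f| = qa f \/ qa f = qc f) -> 0 <= qb f].

(* [fset_set] is the empty fset on infinite sets; for a positive definite f
   the set below is finite. *)
Definition rep_count (f : bqf) (n : nat) : nat :=
  #|` fset_set [set uv : int * int | qeval f uv.1 uv.2 = n%:Z]%classic|%fset.

Definition squarefree (n : nat) : Prop :=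
  forall d : nat, (d ^ 2 %| n)%N -> d = 1%N.

Definition num_divisors (n : nat) : nat := size (divisors n).

(* The Kronecker symbol (m / p) for a prime p; for odd p it is the Legendre
   symbol. *)
Definition kronecker_prime (m : int) (p : nat) : int :=
  if (p%:Z %| m)%Z then 0
  else if p == 2%N then
    if (m == 1 %[mod 8])%Z || (m == 7 %[mod 8])%Z then 1 else -1
  else if [exists y : 'I_p, ((y%:Z) ^+ 2 == m %[mod p%:Z])%Z] then 1
  else -1.

(* The Kronecker symbol (m / n) for n >= 0. *)
Definition kronecker (m : int) (n : nat) : int :=
  if n == 0%N then (`|m| == 1)%:Z
  else \prod_(p <- primes n) kronecker_prime m p ^+ logn p n.

Definition multiplicative_fun (R : realType) (g : nat -> R) : Prop :=
  g 1%N = 1 /\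
  forall m n : nat, (0 < m)%N -> (0 < n)%N -> coprime m n ->
    g (m * n)%N = g m * g n.

(* Main.v *)
(* The condition [l | f(u, v)] selects [zeros_mod f l = l^2 g(l) <= tau(l) l]
   classes modulo [l], and the points of one class in the ellipse [f <= x] form a
   shifted copy of Z^2 inside [f <= x / l^2].  In such an ellipse a row contains
   as many points as the length of its chord, minus two values of the sawtooth
   [psi].  By the midpoint rule for a concave function the chords add up to the
   area, up to the square root of the number of rows.  The sum of [psi] along the
   boundary is bounded by an elementary form of van der Corput's estimate: if the
   second differences of [f] are of size [-1 / Q^3], then
   [\sum_(i < N) psi (f i) << N / Q + Q^2].  Indeed, while the slope of [f] is
   close to [p / q] with [q <= Q], summing over full periods modulo [q] turns [f]
   into the slowly varying sequence [q f(j q)], along which [psi] can be compared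
   with its integral.  This costs [(Q / q)^(3/2)] for each fraction, and the sum
   of these costs over all fractions met by the slope loses no logarithm.  The
   boundary of the ellipse is cut dyadically according to the distance from the
   last row, so that the curvature is of constant size on each piece. *)
Require Import Defs.
From mathcomp Require Import all_boot all_order all_algebra finmap.
From mathcomp Require Import all_classical all_reals all_analysis.
From mathcomp Require Import zify ring lra.
Import Order.TTheory GRing.Theory Num.Theory.
Import numFieldNormedType.Exports.
Local Open Scope ring_scope.

(** Completing the square turns one class into the region [(y + rho z)^2 <= kappa^2 (V^2 - z^2)]
    with [kappa = sqrt D / (2 a)]. Away from its tips the boundary has second differences of size
    about [kappa / V], so [w = (kappa / V)^(1/3)] plays the role of [1 / Q]. The term [N / Q]
    becomes [w V = (kappa V^2)^(1/3)], the cube root of the area up to a constant; this is the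
    source of [x^(1/3) / D^(1/6)]. The term [Q^2] is dominated by it because [kappa >= 1/2], which
    reducedness provides through [a^2 <= D]. The midpoint rule costs [kappa sqrt V], the source of
    the term in [x^(1/4)]. No logarithm appears because a slope interval of length [S] meets at most
    [q (S + 4)] fractions of denominator [q]: the costs add up to [(S + 4) Q^(3/2)] times the sum of
    [q^(-1/2)], hence to [O(S Q^2 + Q^2)], and [S Q^2] is [O(N / Q)]. The obstacle is that the
    summation range must be cut into blocks whose length depends on the fraction being served; a
    greedy choice settles this. Integrals enter only through explicit primitives, [psi ^+ 2 / 2] for
    the sawtooth and [area] for the ellipse. *)

Ltac nlia := try match goal with T : realType |- _ => clear dependent T end; lia.
Ltac nnia := try match goal with T : realType |- _ => clear dependent T end; nia.

(** * The sawtooth function *)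

Definition psi {R : realType} (y : R) : R := y - (Num.floor y)%:~R - 2^-1.

Lemma psi_range (R : realType) (y : R) : - 2^-1 <= psi y < 2^-1.
Proof.
rewrite /psi; have /andP[] := floor_itv y; rewrite intrD; lra.
Qed.

Lemma psi_abs (R : realType) (y : R) : `|psi y| <= 2^-1.
Proof. by have := psi_range R y; rewrite ler_norml; lra. Qed.

Lemma psi_int (R : realType) (y : R) (n : int) : psi (y + n%:~R) = psi y.
Proof. by rewrite /psi floorDrz ?intr_int // intrKfloor intrD; ring. Qed.

(** All jumps of [psi] go down, so it can increase only by drift. This one-sided Lipschitz bound is
    what makes the block estimates insensitive to the discontinuities. *)
Lemma psi_drift (R : realType) (x y : R) : x <= y -> psi y - psi x <= y - x.
Proof.
move=> /le_floor; rewrite -(ler_int R) /psi; lra.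
Qed.

Lemma int_le0_or_ge1 (R : realType) (k : int) : k%:~R <= (0 : R) \/ (1 : R) <= k%:~R.
Proof.
have [h|h] := leP k 0; [left|right].
  by rewrite -(ler_int R) in h.
by have : (1 <= k)%R by []; rewrite -(ler_int R).
Qed.

(* The difference of [psi ^+ 2 / 2] is the integral of [psi] over [y, y + d]. *)
Lemma psi_sq_le (R : realType) (y d : R) : 0 <= d ->
  psi (y + d) ^+ 2 / 2 - psi y ^+ 2 / 2 <= d * (psi y + d).
Proof.
move=> d0; have := psi_range R (y + d); have := psi_range R y.
have := psi_drift R y (y + d) ltac:(lra).
(* [k] counts the integers crossed. Without a crossing the difference is exactly
   [d * (psi y + d / 2)]. *)
have [k ->] : exists k : int, psi (y + d) = psi y + d - k%:~R.
  by exists (Num.floor (y + d) - Num.floor y); rewrite /psi intrB; ring.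
have := int_le0_or_ge1 R k; set K := k%:~R : R => -[k0|k1] h1 h2 h3.
  have -> : K = 0 by lra.
  nra.
nra.
Qed.

Lemma psi_sq_ge (R : realType) (y d : R) : 0 <= d ->
  d * (psi (y + d) - d) <= psi (y + d) ^+ 2 / 2 - psi y ^+ 2 / 2.
Proof.
move=> d0; have := psi_range R (y + d); have := psi_range R y.
have := psi_drift R y (y + d) ltac:(lra).
have [k ->] : exists k : int, psi (y + d) = psi y + d - k%:~R.
  by exists (Num.floor (y + d) - Num.floor y); rewrite /psi intrB; ring.
have := int_le0_or_ge1 R k; set K := k%:~R : R => -[k0|k1] h1 h2 h3.
  have -> : K = 0 by lra.
  nra.
nra.
Qed.

Lemma sum_modz_perm (q : nat) (p m : int) : (0 < q)%N -> coprimez p q ->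
  \sum_(r < q) ((m + p * r%:Z) %% q)%Z = \sum_(r < q) r%:Z.
Proof.
move=> q0 cpq.
have lt r : (`|((m + p * r%:Z) %% q)%Z| < q)%N.
  have h1 := @modz_ge0 (m + p * r%:Z) q ltac:(lia).
  have h2 := @ltz_pmod (m + p * r%:Z) q ltac:(lia). lia.
pose h (r : 'I_q) : 'I_q := Ordinal (lt r).
have hinj : injective h.
  move=> r s /(congr1 val) /= e.
  have {}e : ((m + p * r%:Z) == (m + p * s%:Z) %[mod q])%Z.
    have h1 := @modz_ge0 (m + p * r%:Z) q ltac:(lia).
    have h2 := @modz_ge0 (m + p * s%:Z) q ltac:(lia).
    apply/eqP; lia.
  move: e; rewrite eqz_mod_dvd.
  have -> : m + p * r%:Z - (m + p * s%:Z) = p * (r%:Z - s%:Z) by ring.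
  rewrite Gauss_dvdzr; last by rewrite coprimez_sym.
  case/dvdzP=> k ek; apply: val_inj => /=.
  have := ltn_ord r; have := ltn_ord s => hs hr.
  have k0 : k = 0 by nia.
  lia.
rewrite [RHS](reindex_inj hinj); apply: eq_bigr => r _ /=.
have h1 := @modz_ge0 (m + p * r%:Z) q ltac:(lia). lia.
Qed.

(** The distribution relation of the first periodic Bernoulli function; multiplication by [p] only
    permutes the residues modulo [q]. *)
Lemma sum_psi_residues (R : realType) (q : nat) (p : int) (y : R) :
  (0 < q)%N -> coprimez p q ->
  \sum_(r < q) psi (y + p%:~R * r%:R / q%:R) = psi (q%:R * y).
Proof.
move=> q0 cpq; have qR : (0 : R) < q%:R by rewrite ltr0n.
set m := Num.floor (q%:R * y).
(* The fractional part of [q y] is below 1, so it cannot carry [m + p r] to the next multiple of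
   [q]. *)
have fl (r : 'I_q) : Num.floor (y + p%:~R * r%:R / q%:R)
                     = ((m + p * r%:Z) %/ q)%Z.
  apply: floor_def; have /andP[] := floor_itv (q%:R * y); rewrite -/m => a1 a2.
  have e := divz_eq (m + p * r%:Z) q.
  have l1 := @modz_ge0 (m + p * r%:Z) q ltac:(lia).
  have l2 := @ltz_pmod (m + p * r%:Z) q ltac:(lia).
  set k := divz _ _ in e *; set s := modz _ _ in e l1 l2.
  have -> : y + p%:~R * r%:R / q%:R = (q%:R * y + p%:~R * r%:R) / q%:R.
    by field; lra.
  rewrite ler_pdivlMr // ltr_pdivrMr //.
  have {}e : m%:~R + p%:~R * r%:R = k%:~R * q%:R + s%:~R :> R.
    by move/(congr1 (fun z : int => z%:~R : R)): e; rewrite !intrD !intrM.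
  move: l1 l2; rewrite -lezD1 -!(ler_int R) !intrD => l1 l2.
  move: a2; rewrite intrD => a2.
  apply/andP; split; first by lra.
  by rewrite mulrDl mul1r; move: l2 => /=; rewrite -pmulrn; lra.
(* Quotients are recovered from numerators minus remainders, and the remainders run once through all
   residues. *)
have sd : (\sum_(r < q) ((m + p * r%:Z) %/ q)%Z) * q%:Z
   = m * q%:Z + (p - 1) * \sum_(r < q) r%:Z.
  rewrite mulr_suml.
  under eq_bigr => r _.
    have -> : ((m + p * r%:Z) %/ q)%Z * q%:Z
       = (m + p * r%:Z) - ((m + p * r%:Z) %% q)%Z.
      by have := divz_eq (m + p * r%:Z) q; lia.
    over.
  rewrite sumrB sum_modz_perm // big_split /= sumr_const card_ord -mulr_sumr.
  by rewrite -mulr_natr natz; ring.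
have s0 : 2 * (\sum_(r < q) r%:R) = q%:R * (q%:R - 1) :> R.
  elim: (q) => [|n IH]; first by rewrite big_ord0; ring.
  by rewrite big_ord_recr /= mulrDr IH -natr1; ring.
rewrite /psi -/m.
under eq_bigr => r _ do rewrite fl.
rewrite !big_split /= !sumr_const !card_ord -[y *+ q]mulr_natr.
rewrite -[(- 2^-1) *+ q]mulr_natr sumrN -mulr_suml -mulr_sumr.
move/(congr1 (fun z : int => z%:~R : R)): sd.
rewrite !intrM intrD !intrM intrB !rmorph_sum /=.
set S := \sum_(r < q) ((_ %/ _)%Z%:~R : R).
have -> : \sum_(r < q) (r%:Z%:~R) = \sum_(r < q) r%:R :> R by [].
set s := \sum_(r < q) _ in s0 *.
move=> sd.
have -> : S = m%:~R + (p%:~R - 1) * (q%:R - 1) / 2.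
  apply: (mulIf (lt0r_neq0 qR)); rewrite -[q%:R in LHS]/(q%:Z%:~R) sd.
  have -> : s = q%:R * (q%:R - 1) / 2 by lra.
  by rewrite -[q%:Z%:~R]/(q%:R); field.
have -> : s = q%:R * (q%:R - 1) / 2 by lra.
by field; lra.
Qed.

(** By [psi_drift], moving every perturbation [e r] up to [hi] or down to [lo] changes each term by
    at most [hi - lo] in the useful direction; the perturbation is then constant and
    [sum_psi_residues] evaluates the sum. *)
Lemma psi_block (R : realType) (q : nat) (p : int) (y lo hi : R) (e : nat -> R) :
  (0 < q)%N -> coprimez p q ->
  (forall r, (r < q)%N -> lo <= e r <= hi) ->
  psi (q%:R * (y + hi)) - q%:R * (hi - lo)
  <= \sum_(r < q) psi (y + p%:~R * r%:R / q%:R + e r)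
  <= psi (q%:R * (y + lo)) + q%:R * (hi - lo).
Proof.
move=> q0 cpq he; have cst (c : R) : q%:R * c = \sum_(r < q) c.
  by rewrite sumr_const card_ord mulr_natl.
rewrite -(sum_psi_residues R q p (y + hi)) // -(sum_psi_residues R q p (y + lo)) //.
rewrite cst -sumrB -big_split /=.
apply/andP; split; apply: ler_sum => r _;
  have /andP[h1 h2] := he r (ltn_ord r).
  have := psi_drift R (y + p%:~R * r%:R / q%:R + e r)
             (y + hi + p%:~R * r%:R / q%:R) ltac:(lra).
  lra.
have := psi_drift R (y + lo + p%:~R * r%:R / q%:R)
   (y + p%:~R * r%:R / q%:R + e r) ltac:(lra).
lra.
Qed.

(** * Sums of the sawtooth along nearly linear sequences *)

Lemma ge_steps (R : realType) (g : nat -> R) (c : R) (a b : nat) : (a <= b)%N ->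
  (forall i, (a <= i < b)%N -> c <= g i.+1 - g i) -> c * (b - a)%N%:R <= g b - g a.
Proof.
move=> /subnK <-; rewrite addnK; elim: (b - a)%N => [|n IH] h.
  by rewrite mulr0 add0n subrr.
have h1 := h (n + a)%N ltac:(lia).
have h2 := IH (fun i hi => h i ltac:(lia)).
rewrite -natr1 addSn; lra.
Qed.

Lemma le_steps (R : realType) (g : nat -> R) (c : R) (a b : nat) : (a <= b)%N ->
  (forall i, (a <= i < b)%N -> g i.+1 - g i <= c) -> g b - g a <= c * (b - a)%N%:R.
Proof.
move=> ab h; have := ge_steps R (fun i => - g i) (- c) a b ab.
have h1 i : (a <= i < b)%N -> - c <= - g i.+1 - - g i by move/h; lra.
move/(_ h1); lra.
Qed.

(** Summation by parts with nondecreasing weights. The induction keeps the sum between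
    [w J * (P J.+1 - M)] and [w J * P J.+1], an invariant that survives an increase of the
    weight. *)
Lemma abel_bound (R : realType) (w P : nat -> R) (J : nat) (W M : R) :
  0 <= M -> 0 <= W ->
  (forall j, (j < J)%N -> 0 <= w j <= W) ->
  (forall j, (j.+1 < J)%N -> w j <= w j.+1) ->
  (forall j, 0 <= P j <= M) ->
  `|\sum_(j < J) w j * (P j.+1 - P j)| <= W * M.
Proof.
move=> M0 W0; case: J => [|J] hw wm hP.
  by rewrite big_ord0 normr0 mulr_ge0.
have : w J * (P J.+1 - M) <= \sum_(j < J.+1) w j * (P j.+1 - P j) <= w J * P J.+1.
  elim: J hw wm => [|J IH] hw wm.
    rewrite big_ord1 /=; have := hw 0%N isT; have := hP 0%N.
    move=> /andP[a1 a2] /andP[a3 a4]; have := mulr_ge0 a3 a1.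
    have : 0 <= w 0%N * (M - P 0%N) by rewrite mulr_ge0 // subr_ge0.
    by move=> h1 h2; apply/andP; split; lra.
  rewrite big_ord_recr /=; have /andP[b1 b2] := IH (fun j hj => hw j ltac:(lia))
     (fun j hj => wm j ltac:(lia)).
  have := wm J (ltnSn _); have := hw J ltac:(lia).
  have := hP J.+1; move=> /andP[a1 a2] /andP[a3 a4] a5.
  have h1 : 0 <= (w J.+1 - w J) * P J.+1 by rewrite mulr_ge0 // subr_ge0.
  have h2 : 0 <= (w J.+1 - w J) * (M - P J.+1) by rewrite mulr_ge0 // subr_ge0.
  by apply/andP; split; lra.
have := hw J (ltnSn _); have := hP J.+1.
move=> /andP[a1 a2] /andP[a3 a4] /andP[b1 b2]; rewrite ler_norml.
have h1 : 0 <= w J * (M - P J.+1) by rewrite mulr_ge0 // subr_ge0.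
have h2 : 0 <= (W - w J) * M by rewrite mulr_ge0 // subr_ge0.
have h3 := mulr_ge0 a3 a1.
by apply/andP; split; lra.
Qed.

Lemma sum_blocks (V : nmodType) (F : nat -> V) (J q : nat) :
  \sum_(i < J * q) F i = \sum_(j < J) \sum_(r < q) F (j * q + r)%N.
Proof.
elim: J => [|J IH]; first by rewrite mul0n !big_ord0.
by rewrite mulSnr big_split_ord /= IH big_ord_recr.
Qed.

(** The value [k = J] stands for an unsuccessful search. *)
Lemma first_index (P : nat -> bool) (J : nat) :
  exists k, [/\ (k <= J)%N, forall j, (j < k)%N -> ~~ P j & (k < J)%N -> P k].
Proof.
elim: J => [|J [k [kJ k1 k2]]]; first by exists 0%N.
have [e|lt] := eqVneq k J; last first.
  exists k; split=> [|//|_]; first by lia.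
  by apply: k2; lia.
have [pk|npk] := boolP (P k); first by exists k; split=> //; lia.
exists k.+1; split=> [//||]; last by lia.
by move=> j; rewrite ltnS leq_eqVlt => /predU1P[->//|/k1].
Qed.

(* Summing over full periods modulo [q] replaces [f] by the slowly increasing
   sequence [Y j = q f(j q)] modulo 1; comparing the sum of [psi] along [Y]
   with the integral of [psi] leaves the telescoping error
   [psi (Y j) - psi (Y j.+1)] plus twice the total increase of [Y]. *)
Lemma psi_tail (R : realType) (f : nat -> R) (q : nat) (p : int) (J : nat) (eta T : R) :
  (0 < q)%N -> coprimez p q -> 0 < eta ->
  (forall i, (i < J * q)%N -> eta <= f i.+1 - f i - p%:~R / q%:R <= T) ->
  (forall i, (i.+1 < J * q)%N -> f i.+2 - f i.+1 <= f i.+1 - f i) ->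
  `|\sum_(i < J * q) psi (f i)| <= 2 * (J * q)%N%:R * q%:R * T + 1
       + (q%:R ^+ 2 * eta)^-1 / 8.
Proof.
move=> q0 cpq eta0 ht hs; have qR : (0 : R) < q%:R by rewrite ltr0n.
pose Y j := q%:R * f (j * q)%N.
(* The increment of [Y] once the integer [p q], invisible to [psi], is removed. *)
pose d j := Y j.+1 - Y j - p%:~R * q%:R.
have e_ge j r r' : (j < J)%N -> (r <= r' <= q)%N ->
    eta * (r' - r)%N%:R <= f (j * q + r')%N - p%:~R * r'%:R / q%:R -
        (f (j * q + r)%N - p%:~R * r%:R / q%:R).
  move=> jJ /andP[rr rq].
  apply: (ge_steps R (fun r => f (j * q + r)%N - p%:~R * r%:R / q%:R)) => // i hi.
  have := ht (j * q + i)%N ltac:(nia).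
  by rewrite addnS -natr1 => /andP[h _]; lra.
have e_le j r r' : (j < J)%N -> (r <= r' <= q)%N ->
    f (j * q + r')%N - p%:~R * r'%:R / q%:R -
        (f (j * q + r)%N - p%:~R * r%:R / q%:R) <= T * (r' - r)%N%:R.
  move=> jJ /andP[rr rq].
  apply: (le_steps R (fun r => f (j * q + r)%N - p%:~R * r%:R / q%:R)) => // i hi.
  have := ht (j * q + i)%N ltac:(nia).
  by rewrite addnS -natr1 => /andP[_ h]; lra.
have dE j : d j = q%:R * (f (j * q + q)%N - p%:~R * q%:R / q%:R -
        (f (j * q + 0)%N - p%:~R * 0%:R / q%:R)).
  by rewrite /d /Y addn0 mulSnr; field; lra.
have d_ge j : (j < J)%N -> q%:R ^+ 2 * eta <= d j.
  move=> jJ; have := e_ge j 0%N q jJ ltac:(lia).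
  by rewrite dE subn0 expr2 -[q%:R * q%:R * _]mulrA ler_pM2l // [q%:R * eta]mulrC.
have d_le j : (j < J)%N -> d j <= q%:R ^+ 2 * T.
  move=> jJ; have := e_le j 0%N q jJ ltac:(lia).
  by rewrite dE subn0 expr2 -[q%:R * q%:R * _]mulrA ler_pM2l // [q%:R * T]mulrC.
have d_gt0 j : (j < J)%N -> 0 < d j.
  by move=> /d_ge; apply: lt_le_trans; rewrite mulr_gt0 // exprn_gt0.
have d_mono j : (j.+1 < J)%N -> d j.+1 <= d j.
  move=> jJ; rewrite !dE ler_pM2l //.
  have s_mono i k : (i + k < J * q)%N -> f (i + k).+1 - f (i + k)%N <= f i.+1 - f i.
    move=> ik.
    have := le_steps R (fun i => f i.+1 - f i) 0 i (i + k)%N ltac:(lia).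
    rewrite mul0r subr_le0; apply=> l hl; rewrite subr_le0; apply: hs; lia.
  have := le_steps R (fun r => f (j.+1 * q + r)%N - f (j * q + r)%N) 0 0 q ltac:(lia).
  rewrite mul0r subr_le0 => H.
  have {}H : f (j.+1 * q + q)%N - f (j * q + q)%N <= f (j.+1 * q + 0)%N - f (j * q + 0)%N.
    apply: H => i hi; have := s_mono (j * q + i)%N q ltac:(nia).
    have -> : (j * q + i + q = j.+1 * q + i)%N by lia.
    rewrite -!addnS; lra.
  lra.
have Yper j : psi (Y j.+1) = psi (Y j + d j).
  have -> : Y j.+1 = Y j + d j + (p * q)%:~R by rewrite /d intrM; ring.
  by rewrite psi_int.
(* The block sum and the mean of [psi] over [[Y j, Y j + d j]] both lie between [psi (Y j.+1) - d j]
   and [psi (Y j) + d j]; the length of that interval is the error, and its main part telescopes in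
   [j]. *)
have blk j : (j < J)%N -> `|\sum_(r < q) psi (f (j * q + r)%N)
     - (d j)^-1 * (psi (Y j.+1) ^+ 2 / 2 - psi (Y j) ^+ 2 / 2)|
     <= 2 * d j + (psi (Y j) - psi (Y j.+1)).
  move=> jJ; rewrite Yper.
  pose e r := f (j * q + r)%N - f (j * q)%N - p%:~R * r%:R / q%:R.
  have := psi_block R q p (f (j * q)%N) 0 (d j / q%:R) e q0 cpq.
  have he r : (r < q)%N -> (0 <= e r <= d j / q%:R).
    move=> rq; have h1 := e_ge j 0%N r jJ ltac:(lia).
    have h2 := e_ge j r q jJ ltac:(lia).
    rewrite mulr_natr in h1; rewrite mulr_natr in h2.
    have h3 : 0 <= eta *+ (r - 0) by rewrite mulrn_wge0 // ltW.
    have h4 : 0 <= eta *+ (q - r) by rewrite mulrn_wge0 // ltW.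
    have -> : d j / q%:R = f (j * q + q)%N - p%:~R * q%:R / q%:R -
        (f (j * q + 0)%N - p%:~R * 0%:R / q%:R).
      by rewrite dE mulrC mulKf //; lra.
    move: h1; rewrite !addn0 /e => h1; apply/andP; split; lra.
  move/(_ he).
  have -> : \sum_(r < q) psi (f (j * q)%N + p%:~R * r%:R / q%:R + e r)
     = \sum_(r < q) psi (f (j * q + r)%N).
    by apply: eq_bigr => r _; congr psi; rewrite /e; ring.
  have -> : q%:R * (f (j * q)%N + d j / q%:R) = Y j + d j by rewrite /Y; field; lra.
  have -> : q%:R * (d j / q%:R - 0) = d j by field; lra.
  rewrite addr0 -/(Y j); case/andP=> b1 b2.
  have d0 := d_gt0 j jJ.
  have i1 := psi_sq_le R (Y j) (d j) (ltW d0).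
  have i2 := psi_sq_ge R (Y j) (d j) (ltW d0).
  set D := _ - _ ^+ 2 / 2 in i1 i2 *.
  have j1 : (d j)^-1 * D <= psi (Y j) + d j by rewrite mulrC ler_pdivrMr // mulrC.
  have j2 : psi (Y j + d j) - d j <= (d j)^-1 * D by rewrite [leRHS]mulrC ler_pdivlMr // mulrC.
  by rewrite ler_norml; apply/andP; split; lra.
have -> : \sum_(i < J * q) psi (f i) =
    \sum_(j < J) (\sum_(r < q) psi (f (j * q + r)%N)
     - (d j)^-1 * (psi (Y j.+1) ^+ 2 / 2 - psi (Y j) ^+ 2 / 2))
    + \sum_(j < J) (d j)^-1 * (psi (Y j.+1) ^+ 2 / 2 - psi (Y j) ^+ 2 / 2).
  by rewrite [X in _ = X + _]sumrB subrK (sum_blocks _ (fun i => psi (f i))).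
apply: (le_trans (ler_normD _ _)); apply: lerD.
  apply: (le_trans (ler_norm_sum _ _ _)).
  apply: (@le_trans _ _ (\sum_(j < J) (2 * (q%:R ^+ 2 * T) + (psi (Y j) - psi (Y j.+1))))).
    apply: ler_sum => j _; apply: (le_trans (blk j (ltn_ord j))).
    by rewrite lerD2r ler_pM2l // d_le.
  rewrite big_split /= sumr_const card_ord.
  have -> : \sum_(i < J) (psi (Y i) - psi (Y i.+1)) = psi (Y 0%N) - psi (Y J).
    by elim: (J) => [|n IH]; rewrite ?big_ord0 ?subrr // big_ord_recr /= IH; ring.
  have -> : (2 * (q%:R ^+ 2 * T)) *+ J = 2 * (J * q)%N%:R * q%:R * T.
    by rewrite natrM -mulr_natr; ring.
  have := psi_range R (Y 0%N); have := psi_range R (Y J); lra.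
(* Concavity of [f] makes the weights [1 / d j] nondecreasing, and [psi ^+ 2 / 2] stays in
   [[0, 1/8]]. *)
apply: (abel_bound R (fun j => (d j)^-1) (fun j => psi (Y j) ^+ 2 / 2)).
- by lra.
- by rewrite invr_ge0 mulr_ge0 ?exprn_ge0 // ltW.
- move=> j jJ; rewrite invr_ge0 (ltW (d_gt0 j jJ)) /= lef_pV2 ?d_ge //.
    by rewrite posrE d_gt0.
  by rewrite posrE mulr_gt0 // exprn_gt0.
- move=> j jJ; rewrite lef_pV2 ?d_mono //; rewrite posrE d_gt0 //; lia.
- move=> j; have := psi_range R (Y j); move: (psi _) => z /andP[z1 z2].
  by apply/andP; split; nra.
Qed.

(** Reading the sequence backwards negates the slopes and keeps concavity, so slopes below [p / q]
    reduce to [psi_tail] with [- p]. The reversed last block also uses the step from [n.-1] to [n],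
    whence the range of the hypotheses. *)
Lemma psi_tail_rev (R : realType) (f : nat -> R) (q : nat) (p : int) (n J : nat) (eta T : R) :
  (0 < q)%N -> (0 < n)%N -> coprimez p q -> 0 < eta ->
  (forall i, (n.-1 <= i < (n + J * q).-1)%N ->
     eta <= p%:~R / q%:R - (f i.+1 - f i) <= T) ->
  (forall i, (n.-1 <= i < (n + J * q).-2)%N -> f i.+2 - f i.+1 <= f i.+1 - f i) ->
  `|\sum_(i < J * q) psi (f (n + i)%N)| <= 2 * (J * q)%N%:R * q%:R * T + 1
       + (q%:R ^+ 2 * eta)^-1 / 8.
Proof.
move=> q0 n0 cpq eta0 ht hs.
pose g i := f ((n + J * q).-1 - i)%N.
have -> : \sum_(i < J * q) psi (f (n + i)%N) = \sum_(i < J * q) psi (g i).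
  rewrite (reindex_inj rev_ord_inj); apply: eq_bigr => i _ /=.
  by congr (psi (f _)); have := ltn_ord i; nlia.
apply: (psi_tail R g q (- p)) => //.
- by rewrite /coprimez gcdNz.
- move=> i hi; have := ht ((n + J * q).-1 - i.+1)%N ltac:(nlia).
  rewrite /g; have -> : (((n + J * q).-1 - i.+1).+1 = (n + J * q).-1 - i)%N by nlia.
  by rewrite rmorphN mulNr /= => /andP[h1 h2]; apply/andP; split; lra.
- move=> i hi; have := hs ((n + J * q).-1 - i.+2)%N ltac:(nlia).
  rewrite /g; have -> : (((n + J * q).-1 - i.+2).+2 = (n + J * q).-1 - i)%N by nlia.
  have -> : (((n + J * q).-1 - i.+2).+1 = (n + J * q).-1 - i.+1)%N by nlia.
  lra.
Qed.

(** Even next to the stationary point a full period costs a bounded amount when [q ^ 2 T] is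
    bounded, instead of [q]. *)
Lemma psi_block_trivial (R : realType) (f : nat -> R) (q : nat) (p : int) (n : nat) (T : R) :
  (0 < q)%N -> coprimez p q ->
  (forall i, (n <= i < n + q)%N -> - T <= f i.+1 - f i - p%:~R / q%:R <= T) ->
  `|\sum_(r < q) psi (f (n + r)%N)| <= 2^-1 + 2 * q%:R ^+ 2 * T.
Proof.
move=> q0 cpq ht; have qR : (0 : R) < q%:R by rewrite ltr0n.
have T0 : 0 <= T by have /andP[h1 h2] := ht n ltac:(nlia); lra.
pose e r := f (n + r)%N - f n - p%:~R * r%:R / q%:R.
have he r : (r < q)%N -> - (q%:R * T) <= e r <= q%:R * T.
  move=> rq; pose g r := f (n + r)%N - p%:~R * r%:R / q%:R.
  have h1 := ge_steps R g (- T) 0 r (leq0n _).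
  have h2 := le_steps R g T 0 r (leq0n _).
  have {}h1 : - T * (r - 0)%N%:R <= g r - g 0%N.
    apply: h1 => i hi; have := ht (n + i)%N ltac:(nlia).
    by rewrite /g addnS -natr1 => /andP[h _]; lra.
  have {}h2 : g r - g 0%N <= T * (r - 0)%N%:R.
    apply: h2 => i hi; have := ht (n + i)%N ltac:(nlia).
    by rewrite /g addnS -natr1 => /andP[_ h]; lra.
  have h3 : T * r%:R <= T * q%:R by rewrite ler_wpM2l // ler_nat ltnW.
  move: h1 h2; rewrite /g /e addn0 subn0 => h1 h2; apply/andP; split; lra.
have := psi_block R q p (f n) _ _ e q0 cpq he.
have -> : \sum_(r < q) psi (f n + p%:~R * r%:R / q%:R + e r)
     = \sum_(r < q) psi (f (n + r)%N).
  by apply: eq_bigr => r _; congr psi; rewrite /e; ring.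
have := psi_range R (q%:R * (f n + q%:R * T)).
have := psi_range R (q%:R * (f n + - (q%:R * T))).
move=> /andP[a1 a2] /andP[a3 a4] /andP[a5 a6].
by rewrite ler_norml; apply/andP; split; lra.
Qed.

Lemma sum_split3 (V : nmodType) (F : nat -> V) (a b c : nat) : (a <= b <= c)%N ->
  \sum_(i < c) F i = \sum_(i < a) F i + \sum_(i < b - a) F (a + i)%N
    + \sum_(i < c - b) F (b + i)%N.
Proof.
move=> h; rewrite -(big_mkord xpredT F) (big_cat_nat _ (n := b)) //=; last by nlia.
rewrite (big_cat_nat _ (m := 0%N) (n := a)) //=; last by nlia.
congr (_ + _ + _); first by rewrite big_mkord.
  by rewrite -{1}[a]add0n big_addn big_mkord; apply: eq_bigr => i _; rewrite addnC.
by rewrite -{1}[b]add0n big_addn big_mkord; apply: eq_bigr => i _; rewrite addnC.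
Qed.

(* The window [|f' - p/q| <= tau] around the stationary point is estimated
   trivially; [tau = 1 / (q ^ 2 Z ^ 3)] balances it against the two tails. *)
Lemma psi_arc (R : realType) (B : R) (Q : nat) (Z : R) (f : nat -> R) (q : nat) (p : int)
    (J : nat) :
  1 <= B -> (0 < q <= Q)%N -> coprimez p q -> 0 < Z -> Z ^+ 2 = Q%:R / q%:R ->
  (0 < J)%N ->
  (forall i, (i < J * q)%N ->
     (B * Q%:R ^+ 3)^-1 <= (f i.+1 - f i) - (f i.+2 - f i.+1) <= B / Q%:R ^+ 3) ->
  f 1%N - f 0%N <= p%:~R / q%:R + (q%:R * Q%:R)^-1 ->
  p%:~R / q%:R - (q%:R * Q%:R)^-1 <= f (J.-1 * q).+1 - f (J.-1 * q)%N ->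
  `|\sum_(i < J * q) psi (f i)| <= 53 * B ^+ 2 * Z ^+ 3.
Proof.
move=> B1 /andP[q0 qQ] cpq Z0 ZE J0 hs hhi hlo.
have qR : (0 : R) < q%:R by rewrite ltr0n.
have QR : (0 : R) < Q%:R by rewrite ltr0n; nlia.
have qQR : q%:R <= Q%:R :> R by rewrite ler_nat.
have q1 : 1 <= q%:R :> R by rewrite (ler_nat _ 1).
set u : R := (q%:R * Q%:R)^-1 in hhi hlo.
have u0 : 0 < u by rewrite invr_gt0 mulr_gt0.
have uq : u * q%:R * Q%:R = 1 by rewrite /u; field; lra.
set lam : R := (B * Q%:R ^+ 3)^-1 in hs.
have lam0 : 0 < lam by rewrite invr_gt0 mulr_gt0 ?exprn_gt0 //; lra.
have lamE : lam * (B * Q%:R ^+ 3) = 1.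
  by rewrite /lam mulVf // lt0r_neq0 // mulr_gt0 ?exprn_gt0 //; lra.
pose t i := f i.+1 - f i - p%:~R / q%:R.
have t_drop a b : (a <= b <= J * q)%N -> lam * (b - a)%N%:R <= t a - t b.
  move=> hab.
  have := ge_steps R (fun i => - t i) lam a b ltac:(nlia).
  have h i : (a <= i < b)%N -> lam <= - t i.+1 - - t i.
    move=> hi; have := hs i ltac:(nlia); rewrite /t => /andP[h _]; lra.
  move/(_ h); lra.
have t_mono a b : (a <= b <= J * q)%N -> t b <= t a.
  move=> hab; have := t_drop a b hab.
  have : 0 <= lam * (b - a)%N%:R by rewrite mulr_ge0 // ltW.
  lra.
have t_top i : (i <= J * q)%N -> t i <= u.
  move=> hi; have := t_mono 0%N i ltac:(nlia); rewrite {2}/t; lra.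
(* The hypothesis controls the slope only at the start of the last block; across that block it falls
   by at most [q B / Q ^ 3 <= B u]. *)
have t_bot i : (i <= J * q)%N -> - (2 * B * u) <= t i.
  move=> hi; have h0 : t (J * q)%N <= t i by apply: t_mono; nlia.
  have h1 : - u <= t (J.-1 * q)%N by rewrite /t; lra.
  have := ge_steps R t (- (B / Q%:R ^+ 3)) (J.-1 * q) (J * q) ltac:(nnia).
  have h i' : (J.-1 * q <= i' < J * q)%N -> - (B / Q%:R ^+ 3) <= t i'.+1 - t i'.
    move=> hi'; have := hs i' ltac:(nlia); rewrite /t => /andP[_ h]; lra.
  move/(_ h); have -> : (J * q - J.-1 * q = q)%N by nnia.
  have : B / Q%:R ^+ 3 * q%:R <= B * u.
    rewrite -mulrA ler_wpM2l; [|lra|]; last first.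
      rewrite mulrC ler_pdivrMr ?exprn_gt0 //.
      have -> : u * Q%:R ^+ 3 = (u * q%:R * Q%:R) * (Q%:R ^+ 2 / q%:R) by field; lra.
      by rewrite uq mul1r ler_pdivlMr // expr2 ler_pM // ltW.
    done.
  have : u <= B * u by rewrite ler_peMl // ltW.
  lra.
have Z1 : 1 <= Z.
  rewrite -(@ler_pXn2r _ 2) ?nnegrE ?ler01 ?(ltW Z0) // expr1n ZE.
  by rewrite ler_pdivlMr // mul1r.
have Z23 : Z ^+ 2 <= Z ^+ 3 by rewrite ler_weXn2l.
have Z13 : 1 <= Z ^+ 3 by rewrite exprn_ege1.
(* Up to the last block the slope drops by at most [2 u], at a rate of at least [lam] per step; this
   limits the length of the arc. *)
have len : (J * q)%N%:R * q%:R <= 3 * B * Q%:R ^+ 2.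
  have h := t_drop 0%N (J.-1 * q)%N ltac:(nnia).
  have h1 : t 0%N <= u by apply: t_top; nlia.
  have h2 : - u <= t (J.-1 * q)%N by rewrite /t; lra.
  have h3 : lam * (J.-1 * q)%N%:R <= 2 * u by move: h; rewrite subn0; lra.
  have h4 : (J.-1 * q)%N%:R * q%:R <= 2 * B * Q%:R ^+ 2.
    rewrite -(ler_pM2l lam0).
    have -> : lam * (2 * B * Q%:R ^+ 2) = 2 * (lam * (B * Q%:R ^+ 3)) / Q%:R by field; lra.
    rewrite lamE mulrA.
    apply: (@le_trans _ _ (2 * u * q%:R)); first by rewrite ler_wpM2r // ltW.
    have -> : 2 * u * q%:R = 2 * (u * q%:R * Q%:R) / Q%:R by field; lra.
    by rewrite uq mulr1.
  have -> : (J * q = J.-1 * q + q)%N by nnia.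
  rewrite natrD mulrDl.
  have h5 : q%:R * q%:R <= Q%:R ^+ 2 :> R by rewrite expr2 ler_pM // ltW.
  have h6 : Q%:R ^+ 2 <= B * Q%:R ^+ 2 by rewrite ler_peMl // exprn_ge0 // ltW.
  lra.
pose tau := (q%:R ^+ 2 * Z ^+ 3)^-1.
have tau0 : 0 < tau by rewrite invr_gt0 mulr_gt0 ?exprn_gt0.
have tauE : (q%:R ^+ 2 * tau)^-1 = Z ^+ 3.
  by rewrite /tau; field; rewrite lt0r_neq0 //=; lra.
have tail_bound (J' : nat) : (J' <= J)%N ->
    2 * (J' * q)%N%:R * q%:R * (2 * B * u) + 1 + (q%:R ^+ 2 * tau)^-1 / 8
    <= 14 * B ^+ 2 * Z ^+ 3.
  move=> hJ'.
  have h1 : (J' * q)%N%:R * q%:R <= 3 * B * Q%:R ^+ 2 :> R.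
    apply: le_trans len; rewrite ler_wpM2r ?(ltW qR) // ler_nat; nnia.
  have h2 : (J' * q)%N%:R * q%:R * u <= 3 * B * Z ^+ 2.
    apply: (@le_trans _ _ (3 * B * Q%:R ^+ 2 * u)); first by rewrite ler_wpM2r // ltW.
    rewrite le_eqVlt; apply/orP; left; apply/eqP.
    by rewrite ZE /u; field; lra.
  have h3 : B * ((J' * q)%N%:R * q%:R * u) <= B * (3 * B * Z ^+ 2).
    by rewrite ler_wpM2l //; lra.
  have h4 : B ^+ 2 * Z ^+ 2 <= B ^+ 2 * Z ^+ 3 by rewrite ler_wpM2l // exprn_ge0 //; lra.
  have h5 : Z ^+ 3 <= B ^+ 2 * Z ^+ 3 by rewrite ler_peMl ?exprn_ege1 // exprn_ge0 // ltW.
  by rewrite tauE; move: h3 h4 h5 Z13; clear; lra.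
(* Blocks before [J1] keep a slope of at least [p / q + tau]; from the start of block [J2] on the
   slope is at most [p / q - tau]. *)
have [J1 [J1J before1 at1]] := first_index (fun j => t (j.+1 * q)%N < tau) J.
have [J2 [J2J before2 at2]] := first_index (fun j => t (j * q)%N <= - tau) J.
have uB : u <= 2 * B * u.
  have : u <= B * u by rewrite ler_peMl // ltW.
  lra.
(* The lower tail starts one block late, because [psi_tail_rev] looks one step before its range. *)
pose J3 := minn J2.+1 J.
have J13 : (J1 <= J3)%N.
  rewrite leq_min J1J andbT; case: leqP => // hlt.
  have := before1 J2 ltac:(nlia); rewrite -leNgt => h1.
  have := at2 ltac:(nlia) => h2.
  have := t_mono (J2 * q)%N (J2.+1 * q)%N ltac:(nnia); lra.
have J3J : (J3 <= J)%N by rewrite geq_minr.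
rewrite (sum_split3 _ (fun i => psi (f i)) (J1 * q) (J3 * q) (J * q)); last by nnia.
have T1 : `|\sum_(i < J1 * q) psi (f i)| <= 14 * B ^+ 2 * Z ^+ 3.
  apply: le_trans (tail_bound J1 J1J); apply: (psi_tail R f q p) => //.
    move=> i hi; apply/andP; split; last by apply: le_trans uB; apply: t_top; nnia.
    have J10 : (0 < J1)%N by nnia.
    have := before1 J1.-1 ltac:(nlia); rewrite -leNgt prednK // => h.
    by apply: (le_trans h); apply: t_mono; nnia.
  move=> i hi; have := hs i ltac:(nnia) => /andP[h _]; lra.
have T3 : `|\sum_(i < J * q - J3 * q) psi (f (J3 * q + i)%N)| <= 14 * B ^+ 2 * Z ^+ 3.
  rewrite -mulnBl.
  have [e|hlt] := eqVneq J3 J.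
    have [B0 Z0'] : 0 <= B /\ 0 <= Z by split; [exact: le_trans ler01 B1|exact: ltW].
    by rewrite e subnn mul0n big_ord0 normr0 !mulr_ge0 // exprn_ge0.
  have hJ2 : J3 = J2.+1 by rewrite /J3; move: hlt; rewrite /J3; nlia.
  have hJ2J : (J2 < J)%N by nlia.
  apply: le_trans (tail_bound (J - J3)%N (leq_subr _ _)).
  apply: (psi_tail_rev R f q p) => //.
  - by rewrite hJ2; nnia.
  - move=> i; rewrite mulnBl subnKC; last by nnia.
    rewrite hJ2 => hi; apply/andP; split.
      have h := t_mono (J2 * q)%N i ltac:(nnia).
      have := at2 hJ2J; move: h; rewrite /t; lra.
    have := t_bot i ltac:(nnia); rewrite /t; lra.
  - move=> i; rewrite mulnBl subnKC; last by nnia.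
    move=> hi; have := hs i ltac:(nnia) => /andP[h _]; lra.
have T2 : `|\sum_(i < J3 * q - J1 * q) psi (f (J1 * q + i)%N)| <= 25 * B ^+ 2 * Z ^+ 3.
  rewrite -mulnBl (sum_blocks _ (fun i => psi (f (J1 * q + i)%N))).
  (* Between the blocks [J1.+1] and [J2.-1] the slope moves by at most [2 tau], which allows
     [2 tau / (lam q) = 2 B Z ^ 3] blocks because [Z ^ 6 = (Q / q) ^ 3]; boundary blocks add at most
     3. *)
  have cnt : (J3 - J1)%N%:R <= 5 * B * Z ^+ 3.
    have h5 : Z ^+ 3 <= B * Z ^+ 3 by rewrite ler_peMl // exprn_ge0 // ltW.
    have [small|big] := leqP (J3 - J1) 2.
      apply: (@le_trans _ _ 2%:R); first by rewrite ler_nat.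
      lra.
    have a1 := at1 ltac:(nlia).
    have := before2 J2.-1 ltac:(nlia); rewrite -ltNge => a2.
    have h := t_drop (J1.+1 * q)%N (J2.-1 * q)%N ltac:(nnia).
    rewrite -mulnBl natrM in h.
    have {}h : lam * (J2.-1 - J1.+1)%N%:R * q%:R <= 2 * tau by move: h; lra.
    have {}h : (J2.-1 - J1.+1)%N%:R <= 2 * (B * Z ^+ 3).
      have k0 : 0 < lam * q%:R by rewrite mulr_gt0.
      rewrite -(ler_pM2l k0); rewrite mulrAC in h; apply: (le_trans h).
      rewrite le_eqVlt; apply/orP; left; apply/eqP.
      have -> : lam * q%:R * (2 * (B * Z ^+ 3)) =
         2 * (lam * (B * Q%:R ^+ 3)) * (Z ^+ 3 * q%:R / Q%:R ^+ 3).
        by field; rewrite lt0r_neq0.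
      rewrite lamE mulr1 /tau; congr (2 * _).
      have z6 : Z ^+ 3 * Z ^+ 3 * q%:R ^+ 3 = Q%:R ^+ 3.
        by rewrite -expr2 -exprM mulnC exprM ZE; field; rewrite lt0r_neq0.
      by rewrite -z6; field; rewrite !lt0r_neq0.
    apply: (@le_trans _ _ ((J2.-1 - J1.+1)%N%:R + 3%:R)).
      rewrite -natrD ler_nat; move: big; rewrite /J3; nlia.
    have -> : 3%:R = 3 :> R by [].
    lra.
  have one j : (j < J3 - J1)%N ->
      `|\sum_(r < q) psi (f (J1 * q + (j * q + r))%N)| <= 5 * B.
    move=> hj; have := psi_block_trivial R f q p (J1 * q + j * q) (2 * B * u) q0 cpq.
    have h i : (J1 * q + j * q <= i < J1 * q + j * q + q)%N ->
       - (2 * B * u) <= f i.+1 - f i - p%:~R / q%:R <= 2 * B * u.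
      move=> hi; apply/andP; split; first by apply: t_bot; nnia.
      by apply: le_trans uB; apply: t_top; nnia.
    move/(_ h).
    under [in X in X -> _]eq_bigr => r _ do rewrite -addnA.
    move=> hh; apply: (le_trans hh).
    have -> : 2 * q%:R ^+ 2 * (2 * B * u) = 4 * B * (u * q%:R * Q%:R) * (q%:R / Q%:R).
      by field; rewrite lt0r_neq0.
    rewrite uq mulr1.
    have : 4 * B * (q%:R / Q%:R) <= 4 * B * 1.
      by rewrite ler_wpM2l ?ler_pdivrMr ?mul1r //; lra.
    lra.
  apply: (le_trans (ler_norm_sum _ _ _)).
  apply: (@le_trans _ _ (\sum_(j < J3 - J1) 5 * B)).
    by apply: ler_sum => j _; apply: one.
  rewrite sumr_const card_ord -mulr_natr.
  have B5 : 0 <= 5 * B by apply: mulr_ge0 => //; exact: le_trans ler01 B1.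
  by have := ler_wpM2l B5 cnt; clear; lra.
apply: (le_trans (ler_normD _ _)); have := ler_normD (\sum_(i < J1 * q) psi (f i))
  (\sum_(i < J3 * q - J1 * q) psi (f (J1 * q + i)%N)).
lra.
Qed.

(** * Rational approximation of the slopes and the sum over all fractions *)

Lemma dirichlet_approx (R : realType) (s : R) (Q : nat) : (0 < Q)%N ->
  exists p : int, exists q : nat,
    [/\ (0 < q <= Q)%N, coprimez p q & `|s - p%:~R / q%:R| <= (q%:R * Q%:R)^-1].
Proof.
move=> Q0; have QR : (0 : R) < Q%:R by rewrite ltr0n.
pose fr (i : nat) : R := i%:R * s - (Num.floor (i%:R * s))%:~R.
have fr01 i : 0 <= fr i < 1.
  rewrite /fr; have /andP[] := floor_itv (i%:R * s); rewrite intrD.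
  by move=> h1 h2; apply/andP; split; lra.
have lt i : (Num.truncn (Q%:R * fr i) < Q)%N.
  have /andP[h1 h2] := fr01 i.
  rewrite truncn_lt_nat; last by rewrite mulr_ge0 // ltW.
  by rewrite -[ltRHS]mulr1 ltr_pM2l.
pose h (i : 'I_Q.+1) : 'I_Q := Ordinal (lt i).
(* Pigeonhole: [Q + 1] multiples of [s] modulo 1 fall into [Q] intervals of length [1 / Q]. *)
have /injectivePn[i0 [j0 nij hij]] : ~~ injectiveb h.
  by apply/injectiveP => /leq_card; rewrite !card_ord ltnn.
wlog ltij : i0 j0 nij hij / (i0 < j0)%N.
  move=> W; case: (ltngtP i0 j0) => [|lt2|/val_inj e]; first exact: W.
    by apply: (W j0 i0) => //; rewrite eq_sym.
  by rewrite e eqxx in nij.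
have close : `|fr i0 - fr j0| <= Q%:R^-1.
  have /(congr1 val) /= e := hij.
  have r0 i : 0 <= Q%:R * fr i by rewrite mulr_ge0 ?(ltW QR) //; case/andP: (fr01 i).
  have a := truncn_itv (r0 i0); have b := truncn_itv (r0 j0).
  rewrite -e in b; move: a b; rewrite -natr1 => /andP[a1 a2] /andP[b1 b2].
  rewrite -(ler_pM2l QR) mulfV ?lt0r_neq0 // -{1}(gtr0_norm QR) -normrM ler_norml.
  by apply/andP; split; lra.
pose q := (j0 - i0)%N.
pose p := Num.floor (j0%:R * s) - Num.floor (i0%:R * s) : int.
have q0 : (0 < q)%N by rewrite subn_gt0.
have qQ : (q <= Q)%N by have := ltn_ord j0; rewrite /q; nlia.
have qR : (0 : R) < q%:R by rewrite ltr0n.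
have app : `|s - p%:~R / q%:R| <= (q%:R * Q%:R)^-1.
  have -> : s - p%:~R / q%:R = (fr j0 - fr i0) / q%:R.
    by rewrite /fr /p intrB /q natrB; [field; rewrite -natrB ?lt0r_neq0 // ltnW | exact: ltnW].
  rewrite normrM normfV (gtr0_norm qR) invfM mulrC ler_wpM2l ?invr_ge0 ?(ltW qR) //.
  by rewrite distrC.
(* Cancelling the common factor keeps the fraction and only enlarges the allowed error
   [1 / (q Q)]. *)
pose d := gcdn `|p| q.
have d0 : (0 < d)%N by rewrite gcdn_gt0 q0 orbT.
have dR : (0 : R) < d%:R by rewrite ltr0n.
have dp : (d%:Z %| p)%Z by rewrite dvdzE dvdn_gcdl.
have dq : (d %| q)%N by rewrite dvdn_gcdr.
have q'0 : (0 < q %/ d)%N by rewrite divn_gt0 // dvdn_leq.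
have q'R : (0 : R) < (q %/ d)%N%:R by rewrite ltr0n.
have eq : q%:R = (q %/ d)%N%:R * d%:R :> R by rewrite -natrM divnK.
have ep : p%:~R = (p %/ d)%Z%:~R * d%:R :> R.
  by rewrite -[d%:R]/(d%:Z%:~R) -intrM divzK.
exists (p %/ d)%Z, (q %/ d)%N; split.
- by rewrite q'0 (leq_trans (leq_div _ _)).
- rewrite /coprimez /gcdz /=; apply/eqP; congr Posz.
  have e1 : (`|(p %/ d)%Z| * d = `|p|)%N.
    by have := divzK dp; move/(congr1 absz); rewrite abszM.
  have e2 : (q %/ d * d = q)%N by rewrite divnK.
  apply/eqP; rewrite -(eqn_pmul2r d0) mul1n muln_gcdl e1 e2 //.
- have -> : (p %/ d)%Z%:~R / (q %/ d)%N%:R = p%:~R / q%:R :> R.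
    by rewrite eq ep; field; lra.
  apply: (le_trans app); rewrite lef_pV2 ?posrE ?mulr_gt0 //.
  by rewrite ler_pM2r // ler_nat leq_div.
Qed.

Lemma seq_argmax (R : realType) (T : eqType) (key : T -> R) (s : seq T) :
  s != [::] -> exists2 a, a \in s & forall b, b \in s -> key b <= key a.
Proof.
elim: s => // x s IH _; have [->|/IH[a ain amax]] := eqVneq s [::].
  by exists x => [|b]; rewrite inE // => /eqP->.
have [h|h] := leP (key a) (key x).
  exists x; first by rewrite mem_head.
  by move=> b; rewrite inE => /predU1P[->//|/amax h']; apply: le_trans h.
exists a; first by rewrite inE ain orbT.
by move=> b; rewrite inE => /predU1P[->|/amax//]; apply: ltW.
Qed.

Lemma psi_sum_trivial (R : realType) (f : nat -> R) (n : nat) :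
  `|\sum_(i < n) psi (f i)| <= n%:R.
Proof.
apply: (le_trans (ler_norm_sum _ _ _)).
apply: (@le_trans _ _ (\sum_(i < n) 1)); last by rewrite sumr_const card_ord.
by apply: ler_sum => i _; apply: (le_trans (psi_abs _ _)); lra.
Qed.

Lemma eq_coprime_fractions (p p' : int) (q q' : nat) :
  coprimez p q -> coprimez p' q' -> p * q'%:Z = p' * q%:Z -> q = q'.
Proof.
move=> c1 c2 e; apply/eqP; rewrite eqn_dvd; apply/andP; split.
  have : (q%:Z %| p * q'%:Z)%Z by rewrite e dvdz_mull.
  by rewrite Gauss_dvdzr // coprimez_sym.
have : (q'%:Z %| p' * q%:Z)%Z by rewrite -e dvdz_mull.
by rewrite Gauss_dvdzr // coprimez_sym.
Qed.

(* The slopes decrease; always serve the largest remaining fraction not lying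
   too far above the current slope, by blocks whose length is its denominator. *)
Lemma psi_greedy (R : realType) (B : R) (Q : nat) (Z : nat -> R) (A : seq (int * nat))
    (f : nat -> R) (N : nat) :
  1 <= B -> (0 < Q)%N ->
  (forall q, (0 < q)%N -> 0 < Z q /\ Z q ^+ 2 = Q%:R / q%:R) ->
  (forall a, a \in A -> coprimez a.1 a.2 && (0 < a.2 <= Q)%N) ->
  (forall i, (i < N)%N ->
     (B * Q%:R ^+ 3)^-1 <= (f i.+1 - f i) - (f i.+2 - f i.+1) <= B / Q%:R ^+ 3) ->
  (forall i p q, (i <= N)%N -> (0 < q <= Q)%N -> coprimez p q ->
     `|f i.+1 - f i - p%:~R / q%:R| <= (q%:R * Q%:R)^-1 -> (p, q) \in A) ->
  `|\sum_(i < N) psi (f i)| <= Q%:R + \sum_(a <- A) 53 * B ^+ 2 * Z a.2 ^+ 3.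
Proof.
move=> B1 Q0 hZ; have QR : (0 : R) < Q%:R by rewrite ltr0n.
have cost0 (A' : seq (int * nat)) : (forall a, a \in A' -> coprimez a.1 a.2 && (0 < a.2 <= Q)%N) ->
    0 <= \sum_(a <- A') 53 * B ^+ 2 * Z a.2 ^+ 3.
  move=> hA; rewrite big_seq sumr_ge0 // => a /hA /andP[_ /andP[a0 _]].
  have [/ltW Z0 _] := hZ _ a0; have B0 : 0 <= B by lra.
  by rewrite !mulr_ge0 // exprn_ge0.
have [n] := ubnP (size A).
elim: n A f N => // n IH A f N szA hA hs cov.
have [NQ|QN] := leqP N Q.
  apply: (le_trans (psi_sum_trivial _ _ _)).
  have := cost0 A hA; have : N%:R <= Q%:R :> R by rewrite ler_nat.
  lra.
(* The Dirichlet fraction of the current slope shows that some candidate is always left in [A]. *)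
have [p' [q' [q'Q cpq' app]]] := dirichlet_approx R (f 1%N - f 0%N) Q Q0.
have in' := cov 0%N p' q' isT q'Q cpq' app.
pose key (a : int * nat) : R := a.1%:~R / a.2%:R.
pose A' := [seq a <- A | key a - (a.2%:R * Q%:R)^-1 <= f 1%N - f 0%N].
have in'' : (p', q') \in A'.
  by rewrite mem_filter in' andbT /key /=; move: app; rewrite ler_norml => /andP[h1 h2]; lra.
have A'0 : A' != [::] by apply: contraTneq in'' => ->.
have [[p q] ain amax] := seq_argmax R _ key A' A'0.
move: (ain); rewrite mem_filter => /andP[/= cand aA].
have /= /andP[cpq qQ] := hA _ aA.
have q0 : (0 < q)%N by case/andP: qQ.
have qR : (0 : R) < q%:R by rewrite ltr0n.
have q'R : (0 : R) < q'%:R by rewrite ltr0n; case/andP: q'Q.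
(* The slope is at most [p' / q' + 1 / (q' Q)]. If [p / q] differs from [p' / q'], it exceeds it by
   at least [1 / (q q') >= 1 / (q' Q)], so the slope lies below [p / q] itself. *)
have top : f 1%N - f 0%N <= p%:~R / q%:R + (q%:R * Q%:R)^-1.
  have u0 : 0 < (q%:R * Q%:R)^-1 :> R by rewrite invr_gt0 mulr_gt0.
  have := amax _ in''; rewrite /key /= => hle.
  have up : f 1%N - f 0%N <= p'%:~R / q'%:R + (q'%:R * Q%:R)^-1.
    by move: app; rewrite ler_norml => /andP[h1 h2]; lra.
  have [eqpq|npq] := eqVneq (p' * q%:Z) (p * q'%:Z).
    have eqq := eq_coprime_fractions _ _ _ _ cpq' cpq eqpq.
    have ep : p' = p.
      apply: (@mulIf _ q%:Z); first by nlia.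
      by rewrite eqpq eqq.
    by rewrite ep eqq in up.
  have lt1 : p'%:~R / q'%:R + (q%:R * q'%:R)^-1 <= p%:~R / q%:R :> R.
    have : p' * q%:Z <= p * q'%:Z.
      rewrite -(ler_int R) !intrM -[q%:Z%:~R]/(q%:R) -[q'%:Z%:~R]/(q'%:R).
      by move: hle; rewrite ler_pdivrMr // mulrAC ler_pdivlMr.
    move=> h; have : p' * q%:Z + 1 <= p * q'%:Z by nlia.
    rewrite -(ler_int R) intrD !intrM -[q%:Z%:~R]/(q%:R) -[q'%:Z%:~R]/(q'%:R) => h1.
    have -> : p'%:~R / q'%:R + (q%:R * q'%:R)^-1 = (p'%:~R * q%:R + 1) / q'%:R / q%:R :> R.
      by field; lra.
    by rewrite ler_pM2r ?invr_gt0 // ler_pdivrMr.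
  have : (q'%:R * Q%:R)^-1 <= (q%:R * q'%:R)^-1 :> R.
    rewrite lef_pV2 ?posrE ?mulr_gt0 // mulrC ler_pM2l // ler_nat.
    by case/andP: qQ.
  lra.
(* The arc ends when the slope has left the window of [p / q] downwards, or when no full block fits
   any more. *)
pose stop j := (f (j * q).+1 - f (j * q)%N < p%:~R / q%:R - (q%:R * Q%:R)^-1)
               || (N < j.+1 * q)%N.
have [J [JN before at_]] := first_index stop N.
have J0 : (0 < J)%N.
  case: (posnP J) => // J0; have := at_ ltac:(nlia).
  rewrite /stop J0 mul0n mul1n => /orP[|].
    by rewrite ltNge; move: cand; rewrite /key /= => h; rewrite lerBlDr in h *; lra.
  by have /andP[_ h] := qQ; nlia.
have JqN : (J * q <= N)%N.
  have := before J.-1 ltac:(nlia); rewrite /stop negb_or -leqNgt prednK //.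
  by case/andP.
have stopJ : stop J.
  have [e|] := eqVneq J N; last by move=> ne; apply: at_; nlia.
  by rewrite /stop; apply/orP; right; nnia.
have [Z0 ZE] := hZ q q0.
have arc : `|\sum_(i < J * q) psi (f i)| <= 53 * B ^+ 2 * Z q ^+ 3.
  apply: (psi_arc R B Q (Z q) f q p J) => //.
    by move=> i hi; apply: hs; nlia.
  have := before J.-1 ltac:(nlia); rewrite /stop negb_or -leNgt.
  by case/andP.
have split_sum : \sum_(i < N) psi (f i) = \sum_(i < J * q) psi (f i)
     + \sum_(i < N - J * q) psi (f (J * q + i)%N).
  rewrite (sum_split3 _ (fun i => psi (f i)) (J * q) (J * q) N); last by rewrite leqnn.
  by rewrite subnn big_ord0 addr0.
rewrite split_sum (big_rem _ aA) /=.
have hA' a : a \in rem (p, q) A -> coprimez a.1 a.2 && (0 < a.2 <= Q)%N.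
  by move=> /mem_rem /hA.
suff : `|\sum_(i < N - J * q) psi (f (J * q + i)%N)|
     <= Q%:R + \sum_(a <- rem (p, q) A) 53 * B ^+ 2 * Z a.2 ^+ 3.
  move=> h; apply: (le_trans (ler_normD _ _)); lra.
(* Either fewer than [q <= Q] terms remain, or the decreasing slope has left the window of [p / q]
   for good. In the latter case [p / q] may be removed from [A] without spoiling the covering
   hypothesis. *)
move: stopJ => /orP[low|over]; last first.
  apply: (le_trans (psi_sum_trivial _ (fun i => f (J * q + i)%N) _)).
  have : (N - J * q)%N%:R <= Q%:R :> R by rewrite ler_nat; have /andP[_ ?] := qQ; nnia.
  have := cost0 _ hA'; lra.
apply: (IH (rem (p, q) A) (fun i => f (J * q + i)%N)) => //.
- rewrite size_rem //; have : (0 < size A)%N by case: (A) aA.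
  by move=> sz0; rewrite -ltnS prednK.
- by move=> i hi /=; rewrite !addnS; apply: hs; nlia.
- move=> i pp qq hi hqq cc /=; rewrite addnS => happ.
  have inA : (pp, qq) \in A by apply: (cov (J * q + i)%N) => //; nlia.
  have [[e1 e2]|ne] := eqVneq (pp, qq) (p, q); last first.
    by move: inA; rewrite (perm_mem (perm_to_rem aA)) inE (negbTE ne).
  exfalso; move: happ; rewrite e1 e2 ler_norml => /andP[h1 _].
  have := le_steps R (fun i => f i.+1 - f i) 0 (J * q) (J * q + i) ltac:(nlia).
  have hh k : (J * q <= k < J * q + i)%N -> f k.+2 - f k.+1 - (f k.+1 - f k) <= 0.
    move=> hk; have := hs k ltac:(nlia) => /andP[hk1 _].
    have : 0 <= (B * Q%:R ^+ 3)^-1 by rewrite invr_ge0 mulr_ge0 ?exprn_ge0 //; lra.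
    lra.
  move/(_ hh); lra.
Qed.

Lemma sum_inv_sqrt (R : realType) (n : nat) :
  \sum_(i < n) (Num.sqrt i.+1%:R)^-1 <= 2 * Num.sqrt n%:R :> R.
Proof.
elim: n => [|n IH]; first by rewrite big_ord0 mulr_ge0 ?sqrtr_ge0.
rewrite big_ord_recr /=; apply: (le_trans (lerD IH (lexx _))).
have ha : Num.sqrt n%:R ^+ 2 = n%:R :> R by rewrite sqr_sqrtr.
have hb : Num.sqrt n.+1%:R ^+ 2 = n%:R + 1 :> R by rewrite sqr_sqrtr // natr1.
have b0 : 0 < Num.sqrt n.+1%:R :> R by rewrite sqrtr_gt0 ltr0n.
move: ha hb b0; set a := Num.sqrt n%:R; set b := Num.sqrt n.+1%:R => ha hb b0.
rewrite -lerBrDl -[leLHS]mul1r ler_pdivrMr //.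
have := sqr_ge0 (a - b); lra.
Qed.

(** [psi_greedy] applied to all fractions near the slope range. The constant is [1 + 106 * 4]: the
    trivial remainder [Q <= Q ^ 2], plus the four extra numerators allowed per denominator. *)
Lemma psi_sum_bound (R : realType) (B : R) (Q : nat) (f : nat -> R) (N : nat) :
  1 <= B -> (0 < Q)%N ->
  (forall i, (i < N)%N ->
     (B * Q%:R ^+ 3)^-1 <= (f i.+1 - f i) - (f i.+2 - f i.+1) <= B / Q%:R ^+ 3) ->
  `|\sum_(i < N) psi (f i)| <= 425 * B ^+ 3 * (N%:R / Q%:R + Q%:R ^+ 2).
Proof.
move=> B1 Q0 hs; have QR : (0 : R) < Q%:R by rewrite ltr0n.
have Q1 : (1 : R) <= Q%:R by rewrite (ler_nat _ 1).
pose Z (q : nat) : R := Num.sqrt Q%:R / Num.sqrt q%:R.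
have hZ q : (0 < q)%N -> 0 < Z q /\ Z q ^+ 2 = Q%:R / q%:R.
  move=> q0; split; first by rewrite divr_gt0 // sqrtr_gt0 // ltr0n.
  by rewrite /Z exprMn exprVn !sqr_sqrtr.
pose s i := f i.+1 - f i.
have smono i j : (i <= j <= N)%N -> s j <= s i.
  move=> hij; have := le_steps R s 0 i j ltac:(nlia).
  have h k : (i <= k < j)%N -> s k.+1 - s k <= 0.
    move=> hk; have := hs k ltac:(nlia); rewrite /s => /andP[h1 _].
    have : 0 <= (B * Q%:R ^+ 3)^-1 by rewrite invr_ge0 mulr_ge0 ?exprn_ge0 //; lra.
    lra.
  move/(_ h); lra.
pose S := s 0%N - s N.
have S0 : 0 <= S by rewrite subr_ge0 smono // leqnn.
have SB : S <= N%:R * (B / Q%:R ^+ 3).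
  have := ge_steps R s (- (B / Q%:R ^+ 3)) 0 N ltac:(nlia).
  have h k : (0 <= k < N)%N -> - (B / Q%:R ^+ 3) <= s k.+1 - s k.
    by move=> hk; have := hs k ltac:(nlia); rewrite /s => /andP[_ h1]; lra.
  move/(_ h); rewrite subn0 /S; lra.
(* A fraction approximating some slope has its numerator within 1 of [[q s_N, q s_0]]; a margin of 1
   below and the [+ 4] in the count absorb this and the rounding. *)
pose p0 q := Num.floor (q%:R * s N) - 1 : int.
pose P q := (Num.truncn (q%:R * S) + 4)%N.
pose A0 : seq (int * nat) :=
  flatten [seq [seq ((p0 q + k%:Z)%R : int, q) | k <- iota 0 (P q)] | q <- iota 1 Q].
pose A := [seq a : int * nat <- A0 | coprimez a.1 a.2].
have in0 p q : (p, q) \in A0 = (0 < q <= Q)%N && (p0 q <= p < p0 q + (P q)%:Z).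
  apply/flatten_mapP/idP => [[q' hq' /mapP[k hk [-> ->]]]|/andP[hq hp]].
    move: hq' hk; rewrite !mem_iota add0n => -> /= hk; move: hk.
    by move: (p0 _) (P _) => a b; clear; lia.
  exists q; first by rewrite mem_iota; clear -hq; lia.
  apply/mapP; exists `|p - p0 q|%N.
    rewrite mem_iota; move: hp; move: (p0 _) (P _) => a b; clear; lia.
  congr (_, _); move: hp; move: (p0 _) (P _) => a b; clear; lia.
have cost : \sum_(a <- A) 53 * B ^+ 2 * Z a.2 ^+ 3
    <= 106 * B ^+ 2 * (S + 4) * Q%:R ^+ 2.
  have Z3 a : 0 <= 53 * B ^+ 2 * Z a ^+ 3.
    have Z0 : 0 <= Z a by rewrite divr_ge0 // sqrtr_ge0.
    have B0 : 0 <= B by lra.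
    by rewrite !mulr_ge0 // exprn_ge0.
  apply: (@le_trans _ _ (\sum_(a <- A0) 53 * B ^+ 2 * Z a.2 ^+ 3)).
    rewrite big_filter big_mkcond /= ler_sum // => a _.
    by case: ifP => // _; apply: Z3.
  rewrite big_flatten /= big_map.
  have -> : \sum_(j <- iota 1 Q) \sum_(a <- [seq ((p0 j + k%:Z)%R : int, j) | k <- iota 0 (P j)])
        53 * B ^+ 2 * Z a.2 ^+ 3
     = \sum_(i < Q) (P i.+1)%:R * (53 * B ^+ 2 * Z i.+1 ^+ 3).
    rewrite -[iota 1 Q]/(iota (1 + 0) Q) iotaDl big_map -(big_mkord xpredT
      (fun i => (P i.+1)%:R * (53 * B ^+ 2 * Z i.+1 ^+ 3))) /index_iota subn0.
    apply: eq_bigr => i _; rewrite big_map add1n /=.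
    by rewrite big_const_seq count_predT size_iota iter_addr_0 [RHS]mulr_natl.
  (* At most [q (S + 4)] numerators times [(Q / q) ^ (3/2)] leaves [q ^ (-1/2)], whose sum up to [Q]
     is at most [2 sqrt Q]. *)
  apply: (@le_trans _ _ (\sum_(i < Q) 53 * B ^+ 2 * (S + 4) * Q%:R * Num.sqrt Q%:R
             * (Num.sqrt i.+1%:R)^-1)).
    apply: ler_sum => i _.
    have qR : (0 : R) < i.+1%:R by rewrite ltr0n.
    have q1 : (1 : R) <= i.+1%:R by rewrite (ler_nat _ 1).
    have Ple : (P i.+1)%:R <= i.+1%:R * (S + 4) :> R.
      rewrite /P natrD.
      have hS0 : 0 <= i.+1%:R * S by rewrite mulr_ge0.
      have /andP[h _] := truncn_itv hS0.
     
      lra.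
    apply: (le_trans (ler_wpM2r (Z3 _) Ple)).
    have [_ ZE] := hZ i.+1 isT.
    rewrite le_eqVlt; apply/orP; left; apply/eqP.
    have -> : Z i.+1 ^+ 3 = Z i.+1 ^+ 2 * Z i.+1 by ring.
    rewrite ZE /Z; move: qR; move: (i.+1%:R : R) => y qR; field.
    by rewrite (lt0r_neq0 qR) lt0r_neq0 // sqrtr_gt0.
  rewrite -mulr_sumr.
  have c0 : 0 <= 53 * B ^+ 2 * (S + 4) * Q%:R * Num.sqrt Q%:R.
    apply: mulr_ge0 (sqrtr_ge0 _); apply: mulr_ge0 (ltW QR).
    by have := sqr_ge0 B => B20; apply: mulr_ge0; lra.
  apply: (le_trans (ler_wpM2l c0 (sum_inv_sqrt R Q))).
  have e : Num.sqrt Q%:R ^+ 2 = Q%:R :> R by rewrite sqr_sqrtr.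
  rewrite le_eqVlt; apply/orP; left; apply/eqP.
  transitivity (106 * B ^+ 2 * (S + 4) * Q%:R * Num.sqrt Q%:R ^+ 2); first by ring.
  by rewrite e; ring.
have main : `|\sum_(i < N) psi (f i)| <= Q%:R + \sum_(a <- A) 53 * B ^+ 2 * Z a.2 ^+ 3.
  apply: psi_greedy => //.
    move=> [p q]; rewrite mem_filter in0 /=; by case/andP=> -> /andP[].
  move=> i p q iN qQ cpq app; rewrite mem_filter in0 /= cpq qQ /=.
  have qR : (0 : R) < q%:R by rewrite ltr0n; case/andP: qQ.
  have hi1 := smono 0%N i ltac:(nlia). have hi2 := smono i N ltac:(nlia).
  have {}app : `|q%:R * s i - p%:~R| <= 1.
    have -> : q%:R * s i - p%:~R = q%:R * (s i - p%:~R / q%:R) by field; lra.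
    rewrite normrM (gtr0_norm qR).
    apply: (@le_trans _ _ (q%:R * (q%:R * Q%:R)^-1)); first by rewrite ler_pM2l.
    by rewrite invfM mulrA mulfV ?lt0r_neq0 // mul1r invf_le1.
  move: app; rewrite ler_norml => /andP[h1 h2].
  have h3 : q%:R * s N <= q%:R * s i by rewrite ler_pM2l.
  have h4 : q%:R * s i <= q%:R * s 0%N by rewrite ler_pM2l.
  have /andP[f1 f2] := floor_itv (q%:R * s N).
  rewrite /p0 /P; apply/andP; split.
    rewrite -(ler_int R) intrB; lra.
  have hS0 : 0 <= q%:R * S by rewrite mulr_ge0 // ltW.
  have /andP[_ h5] := truncn_itv hS0.
  rewrite -(ltr_int R) !intrD -[(_ + 4)%N%:Z%:~R]/((_ + 4)%N%:R) natrD.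
  move: h5 f2; rewrite -natr1 intrD /S;
  rewrite mulrBr; set m := (Num.truncn _)%:R; set m' := (Num.floor _)%:~R.
  rewrite -[(- 1)%:~R]/(- 1); lra.
have Q2 : Q%:R <= Q%:R ^+ 2 :> R by rewrite expr2 ler_peMl // ltW.
have SQ : S * Q%:R ^+ 2 <= B * (N%:R / Q%:R).
  have -> : B * (N%:R / Q%:R) = N%:R * (B / Q%:R ^+ 3) * Q%:R ^+ 2 by field; lra.
  by rewrite ler_wpM2r // exprn_ge0 // ltW.
have B20 : 0 <= B ^+ 2 by rewrite exprn_ge0 //; lra.
have SQ' := ler_wpM2l B20 SQ.
have B23 : B ^+ 2 <= B ^+ 3 by rewrite ler_weXn2l.
have B13 : 1 <= B ^+ 3 by rewrite exprn_ege1.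
have NQ0 : 0 <= N%:R / Q%:R :> R by rewrite divr_ge0.
have Q20 : 0 <= Q%:R ^+ 2 :> R by rewrite exprn_ge0.
have t1 : B ^+ 2 * Q%:R ^+ 2 <= B ^+ 3 * Q%:R ^+ 2 by rewrite ler_wpM2r.
have t2 : Q%:R ^+ 2 <= B ^+ 3 * Q%:R ^+ 2 by rewrite ler_peMl.
have t3 : B ^+ 2 * (B * (N%:R / Q%:R)) = B ^+ 3 * (N%:R / Q%:R) by ring.
have t4 : 0 <= B ^+ 3 * (N%:R / Q%:R) by rewrite mulr_ge0 //; lra.
apply: (le_trans main); lra.
Qed.

(** * The boundary of an ellipse *)

(* With [P = sqrt (A - 1 + 2 w)] and [M = sqrt (A - 1 - 2 w)], one has
   [(2 sqrt A - P - M) (2 sqrt A + P + M) (A + 1 + P M) = 8 (A + w ^ 2)]. *)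
Lemma sqrt_second_diff (R : realType) (A w : R) : 0 <= w -> 0 <= A - 1 - 2 * w ->
  A + w ^+ 2 <= (2 * Num.sqrt A - Num.sqrt (A - 1 + 2 * w) - Num.sqrt (A - 1 - 2 * w))
      * (A * Num.sqrt A) <= 4 * (A + w ^+ 2).
Proof.
move=> w0 hA; have A1 : 1 <= A by lra.
have := sqr_sqrtr (_ : 0 <= A) => /(_ ltac:(lra)).
have := sqr_sqrtr hA.
have := sqr_sqrtr (_ : 0 <= A - 1 + 2 * w) => /(_ ltac:(lra)).
have := sqrtr_ge0 A; have := sqrtr_ge0 (A - 1 + 2 * w); have := sqrtr_ge0 (A - 1 - 2 * w).
set a := Num.sqrt A; set P := Num.sqrt (A - 1 + 2 * w); set M := Num.sqrt _.
move=> M0 P0 a0 hP hM ha.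
have PM : P * M <= A - 1 by have := sqr_ge0 (P - M); lra.
have PM0 : 0 <= P * M by rewrite mulr_ge0.
have PMa : P + M <= 2 * a.
  rewrite -(@ler_pXn2r _ 2) ?nnegrE ?addr_ge0 ?mulr_ge0 //.
  by have := sqr_ge0 (P - M); lra.
have a1 : 0 < a by rewrite lt_def a0 andbT; apply/eqP => e; rewrite e in ha; lra.
have PM2 : (P * M) ^+ 2 = (A - 1) ^+ 2 - 4 * w ^+ 2 by rewrite exprMn hP hM; ring.
have key : (2 * a - P - M) * (2 * a + P + M) * (A + 1 + P * M) = 8 * (A + w ^+ 2).
  have -> : (2 * a - P - M) * (2 * a + P + M) = 2 * (A + 1 - P * M).
    have -> : (2 * a - P - M) * (2 * a + P + M)
       = 4 * a ^+ 2 - P ^+ 2 - M ^+ 2 - 2 * (P * M) by ring.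
    rewrite ha hP hM; ring.
  have -> : 2 * (A + 1 - P * M) * (A + 1 + P * M) = 2 * ((A + 1) ^+ 2 - (P * M) ^+ 2) by ring.
  rewrite PM2; ring.
set x := 2 * a - P - M in key *.
have x0 : 0 <= x by rewrite /x; lra.
have aA : 0 < a * A by rewrite mulr_gt0 //; lra.
have u : (2 * a + P + M) * (A + 1 + P * M) <= (4 * a) * (2 * A) by apply: ler_pM; lra.
have l : (2 * a) * A <= (2 * a + P + M) * (A + 1 + P * M) by apply: ler_pM; lra.
have u' := ler_wpM2l x0 u. have l' := ler_wpM2l x0 l.
rewrite mulrA key in u'; rewrite [leRHS]mulrA key in l'.
by apply/andP; split; lra.
Qed.

(** The factor [425 * B ^ 3] of [psi_sum_bound] at [B = 32], times 4 because both [N / Q] and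
    [Q ^ 2] are at most twice the target. It is made opaque below so that it stays a symbol for the
    arithmetic tactics. *)
Definition circle_const {R : realType} : R := 425 * 32 ^+ 3 * 4.

Lemma circle_const_eq (R : realType) : circle_const = 425 * 32 ^+ 3 * 4 :> R.
Proof. by []. Qed.

Lemma circle_const_ge1 (R : realType) : 1 <= circle_const :> R.
Proof. by rewrite /circle_const; lra. Qed.

Opaque circle_const.

(** At distance comparable to [d] from the tip, [A] is comparable to [d V], so the second difference
    [V ^ 2 / A ^ (3/2)] is comparable to [V ^ 2 / (V d) ^ (3/2)]. *)
Lemma sqrt_second_diff_shell (R : realType) (V d u : R) :
  0 < d -> d <= V -> 0 <= u -> u + 1 <= V -> d / 4 <= V - u -> V - u <= d ->
  let A := V ^+ 2 - u ^+ 2 in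
  let x := 2 * Num.sqrt A - Num.sqrt (A - 1 + 2 * u) - Num.sqrt (A - 1 - 2 * u) in
  V ^+ 2 <= 3 * (Num.sqrt V * Num.sqrt d) ^+ 3 * x
  /\ x * (Num.sqrt V * Num.sqrt d) ^+ 3 <= 32 * V ^+ 2.
Proof.
move=> d0 dV u0 uV e2 e1 A x; have V0 : 0 < V by lra.
have r2 : Num.sqrt V ^+ 2 = V by rewrite sqr_sqrtr // ltW.
have t2 : Num.sqrt d ^+ 2 = d by rewrite sqr_sqrtr // ltW.
have r0 : 0 < Num.sqrt V by rewrite sqrtr_gt0.
have t0 : 0 < Num.sqrt d by rewrite sqrtr_gt0.
move: r2 t2 r0 t0; set r := Num.sqrt V; set t := Num.sqrt d => r2 t2 r0 t0.
have AE : A = (V - u) * (V + u) by rewrite /A; ring.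
have Al : d / 4 * V <= A by rewrite AE; apply: ler_pM; lra.
have Au : A <= d * (2 * V) by rewrite AE; apply: ler_pM; lra.
have dV0 : 0 < d * V by rewrite mulr_gt0.
have A0 : 0 < A by apply: lt_le_trans Al; rewrite mulr_gt0 // divr_gt0.
have hA : 0 <= A - 1 - 2 * u.
  have : (u + 1) ^+ 2 <= V ^+ 2 by rewrite ler_pXn2r // ?nnegrE; lra.
  by rewrite /A; lra.
have := sqrt_second_diff R A u u0 hA.
have -> : A + u ^+ 2 = V ^+ 2 by rewrite /A; ring.
rewrite -/x; clearbody x => /andP[x1 x2].
have sA2 : Num.sqrt A ^+ 2 = A by rewrite sqr_sqrtr // ltW.
have sA0 : 0 < Num.sqrt A by rewrite sqrtr_gt0.
move: sA2 sA0 x1 x2; set a := Num.sqrt A => sA2 sA0 x1 x2.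
have rt0 : 0 < r * t by rewrite mulr_gt0.
have al : r * t / 2 <= a.
  have rt2 : 0 <= r * t / 2 by apply: divr_ge0 => //; exact: ltW.
  rewrite -(@ler_pXn2r _ 2) ?nnegrE ?(ltW sA0) //.
  by rewrite sA2 !exprMn r2 t2; move: Al; clear; lra.
have au : a <= 3 / 2 * (r * t).
  have rt32 : 0 <= 3 / 2 * (r * t) by apply: mulr_ge0 (ltW rt0); exact: divr_ge0.
  rewrite -(@ler_pXn2r _ 2) ?nnegrE ?(ltW sA0) //.
  by rewrite sA2 !exprMn r2 t2; move: Au dV0; clear; lra.
have A3l : (r * t) ^+ 3 <= 8 * (A * a).
  have : (r * t / 2) ^+ 3 <= a ^+ 3.
    by rewrite ler_pXn2r // nnegrE; [apply: divr_ge0; rewrite // ltW|exact: ltW].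
  have -> : a ^+ 3 = A * a by rewrite -sA2; ring.
  by rewrite !exprMn; clear; lra.
have A3u : A * a <= 3 * (r * t) ^+ 3.
  have -> : 3 * (r * t) ^+ 3 = (2 * (r * t) ^+ 2) * (3 / 2 * (r * t)) by field.
  apply: ler_pM (ltW A0) (ltW sA0) _ au.
  by rewrite exprMn r2 t2 [V * d]mulrC mulrCA.
have Aa0 : 0 < A * a by rewrite mulr_gt0.
have x0 : 0 < x.
  have : 0 < x * (A * a) by apply: lt_le_trans x1; rewrite exprn_gt0.
  by rewrite pmulr_lgt0.
split.
  by apply: (le_trans x1); rewrite mulrC ler_pM2r.
have g := ler_wpM2l (ltW x0) A3l.
by move: g x2; clear; lra.
Qed.

(** One dyadic shell. The affine part [c0 + c1 k] has no second difference, so the skewness of the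
    ellipse and the shift of the lattice do not affect the bound. *)
Lemma psi_circle_shell (R : realType) (V kappa beta w c0 c1 : R) (k0 N : nat) :
  0 <= beta -> 2^-1 <= kappa -> 0 < w -> w ^+ 3 * V = kappa ->
  8 <= V - (k0%:R + beta) -> N%:R <= (V - (k0%:R + beta)) / 2 + 1 ->
  `|\sum_(i < N) psi (c0 + c1 * (k0 + i)%N%:R
                        + kappa * Num.sqrt (V ^+ 2 - ((k0 + i)%N%:R + beta) ^+ 2))|
  <= circle_const * (w * Num.sqrt V * Num.sqrt (V - (k0%:R + beta))).
Proof.
move=> b0 kap w0 wV; set d := V - _ => d8 Nd.
have k00 : 0 <= k0%:R :> R by [].
have dV : d <= V by rewrite /d; lra.
have V0 : 0 < V by lra.
have d0 : 0 < d by lra.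
have r2 : Num.sqrt V ^+ 2 = V by rewrite sqr_sqrtr // ltW.
have t2 : Num.sqrt d ^+ 2 = d by rewrite sqr_sqrtr // ltW.
have r0 : 0 < Num.sqrt V by rewrite sqrtr_gt0.
have t0 : 0 < Num.sqrt d by rewrite sqrtr_gt0.
have tr : Num.sqrt d <= Num.sqrt V by rewrite ler_wsqrtr.
move: r2 t2 r0 t0 tr; set r := Num.sqrt V; set t := Num.sqrt d => r2 t2 r0 t0 tr.
(* The second differences on the shell have size [kappa sqrt V / d ^ (3/2) = z ^ 3], so [Q] is taken
   as the integer part of [1 / z]. *)
pose z := w * r / t.
have z0 : 0 < z by rewrite divr_gt0 // mulr_gt0.
have zd : d * z = w * r * t by rewrite /z -t2; field; lra.
have z3 : z ^+ 3 * t ^+ 3 = kappa * r by rewrite /z -wV -r2; field; lra.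
have wrt0 : 0 < w * r * t by rewrite !mulr_gt0.
have c_ge1 : 1 <= circle_const :> R by have := circle_const_ge1 R; lra.
have Nle : N%:R <= d by lra.
have kap0 : 0 <= kappa by lra.
(* For [z > 1] the curvature is too large for any [Q], but then the number of rows is already at
   most [d <= d z = w r t]. *)
have [z1|z1] := leP z 1; last first.
  apply: (le_trans (psi_sum_trivial _ (fun i => c0 + c1 * (k0 + i)%N%:R
     + kappa * Num.sqrt (V ^+ 2 - ((k0 + i)%N%:R + beta) ^+ 2)) _)).
  have h1 : d <= d * z by rewrite ler_peMr // ltW.
  have h2 : w * r * t <= circle_const * (w * r * t) by rewrite ler_peMl // ltW.
  lra.
pose Q := Num.truncn z^-1.
have iz : 1 <= z^-1 by rewrite invf_ge1.
have Q0 : (0 < Q)%N by rewrite truncn_gt0.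
have QR : (0 : R) < Q%:R by rewrite ltr0n.
have Q1 : (1 : R) <= Q%:R by rewrite (ler_nat _ 1).
have /andP[Qz1 Qz2] := truncn_itv (ltW (lt_le_trans ltr01 iz)).
rewrite -/Q -natr1 in Qz1 Qz2.
have zQ1 : z * Q%:R <= 1.
  by have := ler_wpM2l (ltW z0) Qz1; rewrite mulfV // lt0r_neq0.
have zQ2 : 1 <= 2 * (z * Q%:R).
  have : z^-1 <= 2 * Q%:R by lra.
  by move/(ler_wpM2l (ltW z0)); rewrite mulfV ?lt0r_neq0 //; lra.
have zQ3u : z ^+ 3 * Q%:R ^+ 3 <= 1.
  by rewrite -exprMn exprn_ile1 // mulr_ge0 // ltW.
have zQ3l : 1 <= 8 * (z ^+ 3 * Q%:R ^+ 3).
  have : 1 <= (2 * (z * Q%:R)) ^+ 3 by rewrite exprn_ege1.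
  by rewrite !exprMn; lra.
have QR3 : 0 < Q%:R ^+ 3 :> R by rewrite exprn_gt0.
pose f (i : nat) := c0 + c1 * (k0 + i)%N%:R
                      + kappa * Num.sqrt (V ^+ 2 - ((k0 + i)%N%:R + beta) ^+ 2).
have hs i : (i < N)%N ->
    (32 * Q%:R ^+ 3)^-1 <= (f i.+1 - f i) - (f i.+2 - f i.+1) <= 32 / Q%:R ^+ 3.
  move=> iN; pose u := (k0 + i.+1)%N%:R + beta : R.
  have iR : i%:R <= N%:R - 1 :> R by rewrite lerBrDr natr1 ler_nat.
  have i0 : 0 <= i%:R :> R by [].
  have uE : u = V - d + i%:R + 1 by rewrite /u /d natrD -natr1; lra.
  pose A := V ^+ 2 - u ^+ 2.
  have i1 : 0 <= V - d by rewrite subr_ge0.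
  have b1 : 0 <= u by rewrite uE; move: i0 i1; clear; lra.
  have b2 : u + 1 <= V by rewrite uE; move: iR Nd d8; clear; lra.
  have b3 : d / 4 <= V - u by rewrite uE; move: iR Nd d8; clear; lra.
  have b4 : V - u <= d by rewrite uE; move: i0; clear; lra.
  have := sqrt_second_diff_shell R V d u d0 dV b1 b2 b3 b4; rewrite /= -/r -/t -/A.
  have -> : (f i.+1 - f i) - (f i.+2 - f i.+1)
     = kappa * (2 * Num.sqrt A - Num.sqrt (A - 1 + 2 * u) - Num.sqrt (A - 1 - 2 * u)).
    have m1 : A - 1 + 2 * u = V ^+ 2 - ((k0 + i)%N%:R + beta) ^+ 2.
      by rewrite /A /u addnS -natr1; ring.
    have m2 : A - 1 - 2 * u = V ^+ 2 - ((k0 + i.+2)%N%:R + beta) ^+ 2.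
      by rewrite /A /u !addnS -!natr1; ring.
    by rewrite m1 m2 /f /A /u !addnS -!natr1; ring.
  set x := _ - _ - Num.sqrt _ => -[x1 x2].
  have rt3 : 0 < (r * t) ^+ 3 by rewrite exprn_gt0 // mulr_gt0.
  have kV : kappa * V ^+ 2 = z ^+ 3 * (r * t) ^+ 3.
    have -> : z ^+ 3 * (r * t) ^+ 3 = (z ^+ 3 * t ^+ 3) * r ^+ 3 by ring.
    by rewrite z3 -r2; ring.
  have lo : z ^+ 3 <= 3 * (kappa * x).
    rewrite -(ler_pM2r rt3) -kV.
    by have := ler_wpM2l kap0 x1; clear; lra.
  have hi : kappa * x <= 32 * z ^+ 3.
    rewrite -(ler_pM2r rt3) -[32 * _ * _]mulrA -kV.
    by have := ler_wpM2l kap0 x2; clear; lra.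
  apply/andP; split.
    rewrite -div1r ler_pdivrMr; last by rewrite mulr_gt0.
    by have := ler_wpM2r (ltW QR3) lo; move: zQ3l; clear; lra.
  by rewrite ler_pdivlMr //; have := ler_wpM2r (ltW QR3) hi; move: zQ3u; clear; lra.
have main := psi_sum_bound R 32 Q f N ltac:(lra) Q0 hs.
have n1 : N%:R / Q%:R <= 2 * (w * r * t).
  rewrite -zd ler_pdivrMr //.
  have h : 0 <= d * (2 * (z * Q%:R) - 1) by apply: mulr_ge0 (ltW d0) _; rewrite subr_ge0.
  by move: h Nle; clear; lra.
(* This is where [kappa >= 1/2] enters: [z ^ 2] times the right-hand side is
   [2 kappa r / t >= 1]. *)
have n2 : Q%:R ^+ 2 <= 2 * (w * r * t).
  have h1 : z ^+ 2 * Q%:R ^+ 2 <= 1 by rewrite -exprMn exprn_ile1 // mulr_ge0 // ltW.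
  have z20 : 0 < z ^+ 2 by rewrite exprn_gt0.
  rewrite -(ler_pM2l z20); apply: (le_trans h1).
  have -> : z ^+ 2 * (2 * (w * r * t)) = 2 * kappa * (r / t).
    by rewrite -wV -r2 /z; field; rewrite lt0r_neq0.
  have h2 : 1 <= r / t by rewrite ler_pdivlMr // mul1r.
  by apply: (le_trans h2); rewrite ler_peMl ?(le_trans ler01 h2) //; move: kap; clear; lra.
move: main; rewrite circle_const_eq.
have : 0 <= 425 * 32 ^+ 3 :> R by exact: mulr_ge0 (ler0n _ 425) (exprn_ge0 3 (ler0n _ 32)).
move: (425 * 32 ^+ 3 : R) => c c_ge0 main.
apply: (le_trans main); rewrite -(mulrA c) ler_wpM2l //.
by move: n1 n2; clear; lra.
Qed.

(** Each shell at least halves the distance to the tip; [n] bounds that distance and serves as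
    induction measure. The last rows, at distance at most 8, number at most 9. *)
Lemma psi_circle_tail (R : realType) (V kappa beta w c0 c1 : R) (K n k0 : nat) :
  0 <= beta -> 2^-1 <= kappa -> 0 < w -> w ^+ 3 * V = kappa ->
  (forall k, (k < K)%N = (k%:R + beta <= V)) ->
  (k0 <= K)%N -> V - (k0%:R + beta) <= n%:R ->
  `|\sum_(i < K - k0) psi (c0 + c1 * (k0 + i)%N%:R
                        + kappa * Num.sqrt (V ^+ 2 - ((k0 + i)%N%:R + beta) ^+ 2))|
  <= 9 + 4 * circle_const * (w * Num.sqrt V * Num.sqrt (V - (k0%:R + beta))).
Proof.
move=> b0 kap w0 wV hK; elim: n k0 => [|n IH] k0 k0K.
all: set d := V - (k0%:R + beta) => hd.
all: have c_ge1 : 1 <= circle_const :> R by have := circle_const_ge1 R; lra.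
all: have rhs0 : 0 <= w * Num.sqrt V * Num.sqrt d by rewrite !mulr_ge0 ?sqrtr_ge0 // ltW.
all: have rhs1 : 0 <= 4 * circle_const * (w * Num.sqrt V * Num.sqrt d)
       by rewrite mulr_ge0 //; lra.
all: have small : d <= 8 -> `|\sum_(i < K - k0) psi (c0 + c1 * (k0 + i)%N%:R
                        + kappa * Num.sqrt (V ^+ 2 - ((k0 + i)%N%:R + beta) ^+ 2))| <= 9.
1,3: move=> d8; apply: (le_trans (psi_sum_trivial _ (fun i => c0 + c1 * (k0 + i)%N%:R
     + kappa * Num.sqrt (V ^+ 2 - ((k0 + i)%N%:R + beta) ^+ 2)) _));
     have [e|lt] := eqVneq K k0; first by rewrite e subnn.
1,2: have := hK K.-1; have -> : (K.-1 < K)%N by nlia.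
1,2: move/esym => h; have h1 : (K - k0)%N%:R = K.-1%:R + 1 - k0%:R :> R
       by rewrite natr1 prednK ?natrB //; nlia.
1,2: by rewrite h1; move: d8; rewrite /d; lra.
  by have := small ltac:(lra); lra.
have [d8|d8] := leP d 8; first by have := small d8; lra.
pose N := (Num.truncn (d / 2)).+1.
have d20 : 0 <= d / 2 by lra.
have /andP[N1 N2] := truncn_itv d20.
rewrite -/N in N2; have {}N1 : N%:R <= d / 2 + 1 by rewrite /N -natr1; lra.
have kN : (k0 + N <= K)%N.
  have : (k0 + N.-1 < K)%N.
    by rewrite hK natrD; move: N1; rewrite /N -natr1 /d /=; move: d8; rewrite /d; lra.
  by rewrite /N /= addnS.
rewrite (sum_split3 _ (fun i => psi (c0 + c1 * (k0 + i)%N%:R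
     + kappa * Num.sqrt (V ^+ 2 - ((k0 + i)%N%:R + beta) ^+ 2))) N N (K - k0)); last first.
  by rewrite leqnn leq_subRL.
rewrite subnn big_ord0 addr0.
have s1 := psi_circle_shell R V kappa beta w c0 c1 k0 N b0 kap w0 wV (ltW d8) N1.
have d1 : V - ((k0 + N)%N%:R + beta) <= d / 2 by rewrite natrD /d; move: N2; rewrite /d; lra.
have s2 := IH (k0 + N)%N kN ltac:(move: hd; rewrite -natr1; lra).
have -> : \sum_(i < K - k0 - N) psi (c0 + c1 * (k0 + (N + i))%N%:R
     + kappa * Num.sqrt (V ^+ 2 - ((k0 + (N + i))%N%:R + beta) ^+ 2)) =
  \sum_(i < K - (k0 + N)) psi (c0 + c1 * (k0 + N + i)%N%:R
     + kappa * Num.sqrt (V ^+ 2 - ((k0 + N + i)%N%:R + beta) ^+ 2)).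
  by rewrite subnDA; apply: eq_bigr => i _; rewrite addnA.
apply: (le_trans (ler_normD _ _)).
(* Since [sqrt (1/2) <= 3/4], the shell bounds decrease geometrically; the factor 4 of the statement
   is [1 / (1 - 3/4)]. *)
have sq : Num.sqrt (V - ((k0 + N)%N%:R + beta)) <= 3 / 4 * Num.sqrt d.
  apply: (@le_trans _ _ (Num.sqrt (d * (3 / 4) ^+ 2))).
    by rewrite ler_wsqrtr //; lra.
  rewrite sqrtrM; last by lra.
  by rewrite sqrtr_sqr ger0_norm; lra.
have wr : 0 <= w * Num.sqrt V by rewrite mulr_ge0 ?sqrtr_ge0 // ltW.
have c4 : 0 <= 4 * circle_const :> R by lra.
have := ler_wpM2l c4 (ler_wpM2l wr sq).
move: s1; rewrite -/d; lra.
Qed.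

Lemma psi_circle (R : realType) (V kappa beta w c0 c1 : R) (K : nat) :
  0 <= beta -> 0 < V -> 2^-1 <= kappa -> 0 < w -> w ^+ 3 * V = kappa ->
  (forall k, (k < K)%N = (k%:R + beta <= V)) ->
  `|\sum_(k < K) psi (c0 + c1 * k%:R + kappa * Num.sqrt (V ^+ 2 - (k%:R + beta) ^+ 2))|
  <= 9 + 4 * circle_const * (w * V).
Proof.
move=> b0 V0 kap w0 wV hK.
have [n hn] : exists n : nat, V - (0%:R + beta) <= n%:R.
  exists (Num.truncn V).+1; have /andP[_ h] := truncn_itv (ltW V0); lra.
have := psi_circle_tail R V kappa beta w c0 c1 K n 0 b0 kap w0 wV hK (leq0n _) hn.
rewrite subn0 => h; apply: (le_trans h); rewrite lerD2l ler_wpM2l //.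
  by have := circle_const_ge1 R; lra.
rewrite -mulrA ler_pM2l // -{3}[V](sqr_sqrtr (ltW V0)) expr2 ler_wpM2l ?sqrtr_ge0 //.
by rewrite ler_wsqrtr //; lra.
Qed.

(** * The area of a disc *)

(** The primitive, in the angle [x] with [t = V sin x], of the chord minus an affine function of
    [t]; the extra [V cos x] is [dt / dx]. *)
Lemma area_derive (R : realType) (V c0 c1 a x : R) :
  is_derive x 1 (fun y => V ^+ 2 / 2 * (y + sin y * cos y) - c0 * (V * sin y)
                 - c1 / 2 * (V * sin y - a) ^+ 2)
    (V * cos x * (V * cos x - c0 - c1 * (V * sin x - a))).
Proof.
have -> : (fun y : R => V ^+ 2 / 2 * (y + sin y * cos y) - c0 * (V * sin y)
                 - c1 / 2 * (V * sin y - a) ^+ 2)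
   = (V ^+ 2 / 2) \*: (id + (sin * cos)) - c0 \*: (V \*: sin)
       - (c1 / 2) \*: (V \*: sin - cst a) ^+ 2 :> (R -> R) by [].
apply: is_derive_eq; rewrite /= /GRing.scale /=.
have -> : (V \*: sin - cst a) x ^+ 1 = V * sin x - a by [].
have -> : 1 + (sin x * - sin x + cos x * cos x) = 2 * cos x ^+ 2.
  by have := cos2Dsin2 x; lra.
by field.
Qed.

(* Substituting [t = V sin x] keeps all derivatives regular at [t = V]. *)
Lemma area_compare (R : realType) (s V c0 c1 a x1 x2 : R) :
  0 <= V -> - (pi / 2) <= x1 -> x1 <= x2 -> x2 <= pi / 2 ->
  (forall x, x1 <= x <= x2 -> 0 <= s * (V * cos x - c0 - c1 * (V * sin x - a))) ->
  0 <= s * (V ^+ 2 / 2 * ((x2 + sin x2 * cos x2) - (x1 + sin x1 * cos x1))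
      - c0 * (V * sin x2 - V * sin x1)
      - c1 / 2 * ((V * sin x2 - a) ^+ 2 - (V * sin x1 - a) ^+ 2)).
Proof.
move=> V0 h1 h12 h2 H.
have [|c cin e] := @MVT_segment R _ _ x1 x2 h12 (fun x _ => area_derive R V c0 c1 a x).
  by apply: derivable_within_continuous => x _; apply: ex_derive.
move: cin; rewrite in_itv /= => cin.
have cc : 0 <= cos c by apply: cos_ge0_pihalf; case/andP: cin => a1 a2; apply/andP; split; lra.
have := H c cin; set w := s * _ => w0.
have : 0 <= w * (V * cos c * (x2 - x1)).
  by apply: (mulr_ge0 w0 (mulr_ge0 (mulr_ge0 V0 cc) _)); rewrite subr_ge0.
have -> : w * (V * cos c * (x2 - x1))
   = s * (V * cos c * (V * cos c - c0 - c1 * (V * sin c - a)) * (x2 - x1)).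
  by rewrite /w; ring.
rewrite -e; congr (0 <= _); ring.
Qed.

Definition half_chord {R : realType} (V t : R) : R := Num.sqrt (V ^+ 2 - t ^+ 2).

(** The primitive of [half_chord V] that vanishes at 0, in closed form. *)
Definition area {R : realType} (V t : R) : R :=
  (V ^+ 2 * asin (t / V) + t * half_chord V t) / 2.

(** Replaces the integration of a pointwise inequality between the chord and an affine function;
    [s = 1] or [s = -1] selects its direction. *)
Lemma area_le (R : realType) (s V c0 c1 a t1 t2 : R) :
  0 < V -> - V <= t1 -> t1 <= t2 -> t2 <= V ->
  (forall t, t1 <= t <= t2 -> 0 <= s * (half_chord V t - c0 - c1 * (t - a))) ->
  0 <= s * (area V t2 - area V t1 - c0 * (t2 - t1)
            - c1 / 2 * ((t2 - a) ^+ 2 - (t1 - a) ^+ 2)).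
Proof.
move=> V0 h1 h12 h2 H.
have itv t : - V <= t <= V -> -1 <= t / V <= 1.
  by move=> /andP[a1 a2]; rewrite ler_pdivlMr // ler_pdivrMr // mulN1r mul1r a1.
have sinE t : - V <= t <= V -> V * sin (asin (t / V)) = t.
  by move=> /itv ht; rewrite asinK ?in_itv //= mulrC divfK // lt0r_neq0.
have cosE t : - V <= t <= V -> V * cos (asin (t / V)) = half_chord V t.
  move=> ht; rewrite cos_asin ?itv // -{1}[V]ger0_norm ?(ltW V0) // -sqrtr_sqr.
  rewrite -sqrtrM ?sqr_ge0 // /half_chord; congr Num.sqrt.
  by field; lra.
have r1 : - V <= t1 <= V by apply/andP; split; lra.
have r2 : - V <= t2 <= V by apply/andP; split; lra.
have x12 : asin (t1 / V) <= asin (t2 / V).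
  rewrite leNgt; apply/negP => lt.
  have : sin (asin (t2 / V)) < sin (asin (t1 / V)).
    rewrite ltr_sin ?in_itv //= ?asin_geNpi2 ?asin_lepi2 ?itv //.
  rewrite !asinK ?in_itv /= ?itv //.
  by rewrite ltr_pM2r ?invr_gt0 // ltNge h12.
have := area_compare R s V c0 c1 a (asin (t1 / V)) (asin (t2 / V)) (ltW V0)
   (asin_geNpi2 (itv _ r1)) x12 (asin_lepi2 (itv _ r2)).
rewrite !sinE //.
have -> : V ^+ 2 / 2 *
    (asin (t2 / V) + sin (asin (t2 / V)) * cos (asin (t2 / V)) -
     (asin (t1 / V) + sin (asin (t1 / V)) * cos (asin (t1 / V)))) =
    area V t2 - area V t1.
  have e t : - V <= t <= V -> V ^+ 2 / 2 * (asin (t / V) + sin (asin (t / V)) * cos (asin (t / V)))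
      = area V t.
    by move=> ht; rewrite /area -cosE // -[X in _ + X * _](sinE t ht); field.
  by rewrite mulrBr !e.
apply=> x /andP[x1 x2].
have m1 := asin_geNpi2 (itv _ r1); have m2 := asin_lepi2 (itv _ r2).
have xr : x \in `[(- (pi / 2)), pi / 2] by rewrite in_itv /=; apply/andP; split; lra.
have er : asin (V * sin x / V) = x by rewrite mulrAC mulfV ?lt0r_neq0 // mul1r sinK.
have tr : t1 <= V * sin x <= t2.
  have in1 : asin (t1 / V) \in `[(- (pi / 2)), pi / 2] by rewrite in_itv /=; apply/andP; split; lra.
  have in2 : asin (t2 / V) \in `[(- (pi / 2)), pi / 2] by rewrite in_itv /=; apply/andP; split; lra.
  rewrite -{1}(sinE _ r1) -{1}(sinE _ r2) !ler_pM2l //.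
  by rewrite !leNgt !ltr_sin // -!leNgt x1 x2.
have -> : V * cos x = half_chord V (V * sin x).
  rewrite -cosE ?er //; case/andP: tr => b1 b2; apply/andP; split; lra.
exact: H.
Qed.

(** Multiplied by [half_chord V t], the claim bounds the product of the two chords by [V ^ 2 - u t],
    which follows from two squares. *)
Lemma half_chord_tangent (R : realType) (V u t : R) :
  u ^+ 2 <= V ^+ 2 -> t ^+ 2 < V ^+ 2 ->
  half_chord V u <= half_chord V t - t / half_chord V t * (u - t).
Proof.
move=> hu ht; have hu' : 0 <= V ^+ 2 - u ^+ 2 by lra.
have ht' : 0 < V ^+ 2 - t ^+ 2 by lra.
have a2 : half_chord V u ^+ 2 = V ^+ 2 - u ^+ 2 by rewrite sqr_sqrtr.
have b2 : half_chord V t ^+ 2 = V ^+ 2 - t ^+ 2 by rewrite sqr_sqrtr // ltW.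
have b0 : 0 < half_chord V t by rewrite sqrtr_gt0.
move: a2 b2 b0; set a := half_chord V u; set b := half_chord V t => a2 b2 b0.
rewrite -(ler_pM2r b0).
have -> : (b - t / b * (u - t)) * b = b ^+ 2 - t * (u - t) by field; lra.
by rewrite b2; have := sqr_ge0 (a - b); have := sqr_ge0 (u - t); lra.
Qed.

Lemma slope_mono (R : realType) (V u t : R) :
  u <= t -> u ^+ 2 < V ^+ 2 -> t ^+ 2 < V ^+ 2 ->
  u / half_chord V u <= t / half_chord V t.
Proof.
move=> ut hu ht.
have t1 := half_chord_tangent R V u t (ltW hu) ht.
have t2 := half_chord_tangent R V t u (ltW ht) hu.
move: t1 t2; set x := u / _; set y := t / _ => t1 t2.
have [e|ne] := eqVneq u t; first by rewrite /x /y e.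
have lt0 : 0 < t - u by rewrite subr_gt0 lt_neqAle ne.
by rewrite -(ler_pM2r lt0); lra.
Qed.

(** The tangent at the midpoint bounds the area from above. The error is expressed by a difference
    of boundary slopes so that it telescopes over consecutive rows. *)
Lemma midpoint_error (R : realType) (V v : R) : 0 < V -> 0 <= v ->
  2^-1 < V -> v + 2^-1 < V ->
  0 <= half_chord V v - (area V (v + 2^-1) - area V (v - 2^-1))
    <= ((v + 2^-1) / half_chord V (v + 2^-1) - (v - 2^-1) / half_chord V (v - 2^-1)) / 8.
Proof.
move=> V0 v0 V1 vV.
have sq t : v - 2^-1 <= t -> t <= v + 2^-1 -> t ^+ 2 < V ^+ 2.
  move=> h1 h2; have -> : V ^+ 2 = t ^+ 2 + (V - t) * (V + t) by ring.
  by rewrite ltrDl mulr_gt0 //; lra.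
pose p := (v + 2^-1) / half_chord V (v + 2^-1).
pose m := (v - 2^-1) / half_chord V (v - 2^-1).
rewrite -/p -/m.
have up := area_le R (-1) V (half_chord V v) (- (v / half_chord V v)) v
   (v - 2^-1) (v + 2^-1) V0 ltac:(lra) ltac:(lra) ltac:(lra).
have hup t : v - 2^-1 <= t <= v + 2^-1 ->
   0 <= -1 * (half_chord V t - half_chord V v - - (v / half_chord V v) * (t - v)).
  move=> /andP[h1 h2].
  have := half_chord_tangent R V t v (ltW (sq t h1 h2)) (sq v ltac:(lra) ltac:(lra)); lra.
have {hup}up := up hup.
(* From below, each half of the interval is compared with the line through the midpoint having the
   tangent slope of the outer end; the two integrals account for [p / 8] and [- m / 8]. *)
have lo1 := area_le R 1 V (half_chord V v) (- p) v
   v (v + 2^-1) V0 ltac:(lra) ltac:(lra) ltac:(lra).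
have hlo1 t : v <= t <= v + 2^-1 ->
   0 <= 1 * (half_chord V t - half_chord V v - (- p) * (t - v)).
  move=> /andP[h1 h2].
  have h3 := half_chord_tangent R V v t (ltW (sq v ltac:(lra) ltac:(lra))) (sq t ltac:(lra) h2).
  have h4 := slope_mono R V t (v + 2^-1) h2 (sq t ltac:(lra) h2)
    (sq (v + 2^-1) ltac:(lra) (lexx _)).
  have : 0 <= (p - t / half_chord V t) * (t - v) by rewrite mulr_ge0 // subr_ge0.
  lra.
have {hlo1}lo1 := lo1 hlo1.
have lo2 := area_le R 1 V (half_chord V v) (- m) v
   (v - 2^-1) v V0 ltac:(lra) ltac:(lra) ltac:(lra).
have hlo2 t : v - 2^-1 <= t <= v ->
   0 <= 1 * (half_chord V t - half_chord V v - (- m) * (t - v)).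
  move=> /andP[h1 h2].
  have h3 := half_chord_tangent R V v t (ltW (sq v ltac:(lra) ltac:(lra))) (sq t h1 ltac:(lra)).
  have h4 := slope_mono R V (v - 2^-1) t h1 (sq (v - 2^-1) (lexx _) ltac:(lra))
    (sq t h1 ltac:(lra)).
  have : 0 <= (t / half_chord V t - m) * (v - t) by rewrite mulr_ge0 // subr_ge0.
  lra.
have {hlo2}lo2 := lo2 hlo2.
by apply/andP; split; lra.
Qed.

Lemma area_N (R : realType) (V t : R) : 0 < V -> - V <= t <= V ->
  area V (- t) = - area V t.
Proof.
move=> V0 /andP[t1 t2].
have itv : -1 <= t / V <= 1 by rewrite ler_pdivlMr // ler_pdivrMr // mulN1r mul1r t1.
have e : asin (- t / V) = - asin (t / V).
  rewrite mulNr -[in LHS](@asinK R (t / V)) ?in_itv //= -sinN sinK // in_itv /=.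
  have := asin_geNpi2 itv; have := asin_lepi2 itv => a1 a2.
  by apply/andP; split; lra.
by rewrite /area /half_chord e sqrrN; ring.
Qed.

Lemma area_V (R : realType) (V : R) : 0 < V -> area V V = pi * V ^+ 2 / 4.
Proof.
move=> V0; rewrite /area /half_chord subrr sqrtr0 mulfV ?lt0r_neq0 //.
have -> : asin 1 = pi / 2 :> R.
  rewrite -[RHS](@sinK R) ?sin_pihalf // in_itv /= lexx andbT.
  by have := pihalf_ge1 R; lra.
by field.
Qed.

(** The telescoped midpoint errors amount to the slope half a unit above the last treated row. There
    the distance to [V] is at least 1/2, so the slope is [O(sqrt V)], like the last row and the
    strip beyond. *)
Lemma half_circle_sum (R : realType) (V beta : R) (K : nat) :
  1 <= V -> 0 <= beta <= 1 -> (forall k, (k < K)%N = (k%:R + beta <= V)) ->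
  `|\sum_(k < K) half_chord V (k%:R + beta) - (area V V - area V (beta - 2^-1))|
  <= 6 * Num.sqrt V.
Proof.
move=> V1 /andP[b0 b1] hK; have V0 : 0 < V by lra.
have K0 : (0 < K)%N by rewrite hK; lra.
case: K K0 hK => // K _ hK.
have KV : K%:R + beta <= V by rewrite -hK.
have KV' : V < K.+1%:R + beta by rewrite ltNge -hK ltnn.
rewrite -natr1 in KV'.
pose slope t := t / half_chord V t.
(* The top row is excluded, since half a unit above it may lie outside the disc. *)
have main m : (m <= K)%N ->
   0 <= \sum_(k < m) half_chord V (k%:R + beta)
        - (area V (m%:R + beta - 2^-1) - area V (beta - 2^-1))
     <= (slope (m%:R + beta - 2^-1) - slope (beta - 2^-1)) / 8.
  elim: m => [|m IH] mK.
    by rewrite big_ord0 mulr0n !add0r !subrr oppr0 mul0r lexx.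
  have mR : m%:R <= K%:R - 1 :> R by rewrite lerBrDr natr1 ler_nat.
  have m0 : 0 <= m%:R :> R by [].
  have := midpoint_error R V (m%:R + beta) V0 ltac:(lra) ltac:(lra) ltac:(lra).
  have := IH (ltnW mK); rewrite big_ord_recr /= -[m.+1%:R]natr1 -/(slope _) -/(slope _).
  have -> : m%:R + 1 + beta - 2^-1 = m%:R + beta + 2^-1 :> R by field.
  by move=> /andP[a1 a2] /andP[a3 a4]; apply/andP; split; lra.
have /andP[m1 m2] := main K (leqnn K).
set t0 := K%:R + beta - 2^-1 in m1 m2.
have Kn0 : 0 <= K%:R :> R by [].
set r := Num.sqrt V.
have r2 : r ^+ 2 = V by rewrite sqr_sqrtr // ltW.
have r1 : 1 <= r by rewrite -[1]sqrtr1 ler_wsqrtr.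
have lastt : half_chord V (K%:R + beta) <= 2 * r.
  rewrite -(@ler_pXn2r _ 2) ?nnegrE ?sqrtr_ge0 //; last by lra.
  rewrite sqr_sqrtr; last first.
    have -> : V ^+ 2 - (K%:R + beta) ^+ 2 = (V - (K%:R + beta)) * (V + (K%:R + beta)) by ring.
    by rewrite mulr_ge0 //; lra.
  rewrite exprMn r2.
  have -> : V ^+ 2 - (K%:R + beta) ^+ 2 = (V - (K%:R + beta)) * (V + (K%:R + beta)) by ring.
  have : (V - (K%:R + beta)) * (V + (K%:R + beta)) <= 1 * (2 * V) by apply: ler_pM; lra.
  lra.
have last0 : 0 <= half_chord V (K%:R + beta) by rewrite sqrtr_ge0.
have slope_top : slope t0 <= 2 * r.
  have [t00|t00] := leP t0 0.
    have : slope t0 <= 0 by rewrite /slope mulr_le0_ge0 // invr_ge0 sqrtr_ge0.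
    lra.
  have hV : r / 2 <= half_chord V t0.
    rewrite -(@ler_pXn2r _ 2) ?nnegrE ?sqrtr_ge0 //; last by lra.
    have e : V ^+ 2 - t0 ^+ 2 = (V - t0) * (V + t0) by ring.
    have h : 2^-1 * V <= (V - t0) * (V + t0) by apply: ler_pM; rewrite /t0 in t00 *; lra.
    rewrite sqr_sqrtr; last by rewrite e; lra.
    by rewrite exprMn r2 e; lra.
  rewrite /slope ler_pdivrMr; last by lra.
  have : 2 * r * (r / 2) <= 2 * r * half_chord V t0 by rewrite ler_wpM2l //; lra.
  have -> : 2 * r * (r / 2) = r ^+ 2 by field.
  rewrite r2 /t0; lra.
have slope_bot : - 1 <= slope (beta - 2^-1).
  have hV : 2^-1 <= half_chord V (beta - 2^-1).
    rewrite -(@ler_pXn2r _ 2) ?nnegrE ?sqrtr_ge0 //.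
    have e : (beta - 2^-1) ^+ 2 <= 2^-1 ^+ 2 :> R.
      have : 0 <= beta * (1 - beta) by rewrite mulr_ge0 //; lra.
      lra.
    have e2 : 1 <= V ^+ 2 by rewrite exprn_ege1.
    rewrite sqr_sqrtr; lra.
  rewrite /slope ler_pdivlMr; lra.
have hc t : t0 <= t <= V -> 0 <= half_chord V t <= 2 * r.
  move=> /andP[h1 h2]; rewrite sqrtr_ge0 /=.
  rewrite -(@ler_pXn2r _ 2) ?nnegrE ?sqrtr_ge0 //; last by lra.
  have e : V ^+ 2 - t ^+ 2 = (V - t) * (V + t) by ring.
  have h : (V - t) * (V + t) <= (3 / 2) * (2 * V) by apply: ler_pM; rewrite /t0 in h1; lra.
  have h' : 0 <= (V - t) * (V + t) by rewrite mulr_ge0 //; rewrite /t0 in h1; lra.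
  by rewrite sqr_sqrtr e // exprMn r2; lra.
(* The strip beyond [t0] has width at most 3/2 and height at most [2 r]; it is compared with the
   constants 0 and [2 r]. *)
have e1 := area_le R 1 V 0 0 0 t0 V V0 ltac:(rewrite /t0; lra) ltac:(rewrite /t0; lra) (lexx _).
have e1' t : t0 <= t <= V -> 0 <= 1 * (half_chord V t - 0 - 0 * (t - 0)).
  by move/hc => /andP[h1 h2]; lra.
have {e1'}e1 := e1 e1'.
have e2 := area_le R (-1) V (2 * r) 0 0 t0 V V0
  ltac:(rewrite /t0; lra) ltac:(rewrite /t0; lra) (lexx _).
have e2' t : t0 <= t <= V -> 0 <= -1 * (half_chord V t - 2 * r - 0 * (t - 0)).
  by move/hc => /andP[h1 h2]; lra.
have {e2'}e2 := e2 e2'.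
have e3 : 2 * r * (V - t0) <= 2 * r * (3 / 2) by rewrite ler_wpM2l ?/t0 //; lra.
rewrite big_ord_recr /= ler_norml; apply/andP; split; lra.
Qed.

(** * Lattice points in shifted ellipses *)

Lemma sum_itv_indicator (A B M : nat) : (A <= B <= M)%N ->
  (\sum_(i < M) (A <= i < B)%N)%N = (B - A)%N.
Proof.
move=> h; rewrite (_ : (B - A)%N = (minn B M - A)%N); last by lia.
have {h} : (A <= B)%N by lia.
elim: M => [|M IH] h; first by rewrite big_ord0; lia.
by rewrite big_ord_recr /= IH //; case: leqP; case: ltnP => /=; lia.
Qed.

(** The count is [floor y2 + floor (- y1) + 1], and each floor plus 1/2 is its argument minus
    [psi]. *)
Lemma row_count (R : realType) (y1 y2 : R) (N : nat) :
  y1 <= y2 -> - N%:R <= y1 -> y2 + 1 <= N%:R ->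
  (\sum_(i < 2 * N) (y1 <= i%:R - N%:R <= y2)%R)%N%:R = y2 - y1 - psi y2 - psi (- y1).
Proof.
move=> h12 h1 h2.
pose p := Num.floor y2; pose q := - Num.floor (- y1).
have /andP[p1 p2] := floor_itv y2. have /andP[q1 q2] := floor_itv (- y1).
rewrite -/p intrD in p1 p2.
have qE : (Num.floor (- y1))%:~R = - q%:~R :> R by rewrite /q intrN opprK.
rewrite intrD qE in q2; rewrite qE in q1.
have qp : q <= p + 1 by rewrite -ltzD1 -(ltr_int R) !intrD; lra.
have Nq : - N%:Z <= q by rewrite -(ler_int R) intrN -[N%:Z%:~R]/(N%:R); lra.
have pN : p + 1 <= N%:Z by rewrite -(ler_int R) intrD -[N%:Z%:~R]/(N%:R); lra.
have -> : (\sum_(i < 2 * N) (y1 <= i%:R - N%:R <= y2)%R)%N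
   = (\sum_(i < 2 * N) (absz (q + N%:Z)%R <= i < absz (p + 1 + N%:Z)%R))%N.
  apply: eq_bigr => i _; congr nat_of_bool.
  have e : i%:R - N%:R = (i%:Z - N%:Z)%:~R :> R by rewrite intrB.
  have -> : (y1 <= i%:R - N%:R) = (q <= i%:Z - N%:Z).
    rewrite e; apply/idP/idP => h.
      by rewrite -ltzD1 -(ltr_int R) intrD; lra.
    by move: h; rewrite -(ler_int R); lra.
  have -> : (i%:R - N%:R <= y2) = (i%:Z - N%:Z <= p) by rewrite e floor_ge_int.
  by clear -Nq pN qp; lia.
rewrite sum_itv_indicator; last by clear -Nq pN qp; lia.
rewrite natrB; last by clear -Nq pN qp; lia.
have ab (z : int) : 0 <= z -> (absz z)%:R = z%:~R :> R by move=> z0; rewrite -[in RHS](gez0_abs z0).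
rewrite !ab; [|clear -Nq pN qp; lia|clear -Nq pN qp; lia].
by rewrite /psi -/p qE !intrD; lra.
Qed.

(** The two ends of the rows give two sawtooth sums with linear parts [- rho k] and [rho k];
    [psi_circle] bounds both. *)
Lemma half_ellipse_points (R : realType) (rho kappa V w alpha beta : R) (N K : nat) :
  0 < V -> 2^-1 <= kappa -> 0 < w -> w ^+ 3 * V = kappa ->
  0 <= alpha <= 1 -> 0 <= beta <= 1 -> V + (`|rho| + kappa) * V + 3 <= N%:R ->
  (forall k, (k < K)%N = (k%:R + beta <= V)) ->
  `|(\sum_(k < N) \sum_(i < 2 * N)
       ((i%:R - N%:R + alpha + rho * (k%:R + beta)) ^+ 2
         <= kappa ^+ 2 * (V ^+ 2 - (k%:R + beta) ^+ 2))%R)%N%:R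
    - 2 * kappa * \sum_(k < K) half_chord V (k%:R + beta)|
  <= 18 + 8 * circle_const * (w * V).
Proof.
move=> V0 kap w0 wV /andP[al0 al1] /andP[b0 b1] NV hK.
have rV : 0 <= (`|rho| + kappa) * V by rewrite mulr_ge0 ?addr_ge0 //; lra.
have KN : (K <= N)%N.
  rewrite leqNgt hK -ltNge; lra.
have kap0 : 0 < kappa by lra.
have -> : (\sum_(k < N) \sum_(i < 2 * N)
       ((i%:R - N%:R + alpha + rho * (k%:R + beta)) ^+ 2
         <= kappa ^+ 2 * (V ^+ 2 - (k%:R + beta) ^+ 2))%R)%N
  = (\sum_(k < K) \sum_(i < 2 * N)
       ((i%:R - N%:R + alpha + rho * (k%:R + beta)) ^+ 2
         <= kappa ^+ 2 * (V ^+ 2 - (k%:R + beta) ^+ 2))%R)%N.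
  rewrite (sum_split3 _ (fun k : nat => (\sum_(i < 2 * N)
       ((i%:R - N%:R + alpha + rho * (k%:R + beta)) ^+ 2
         <= kappa ^+ 2 * (V ^+ 2 - (k%:R + beta) ^+ 2))%R)%N) K K N); last by rewrite leqnn.
  rewrite subnn big_ord0 addr0 [X in _ + X]big1 ?addr0 // => k _.
  apply: big1 => i _; apply/eqP; rewrite eqb0 -ltNge.
  have : ~~ (K + k < K)%N by rewrite -leqNgt leq_addr.
  rewrite hK -ltNge => hv.
  have : V ^+ 2 < ((K + k)%N%:R + beta) ^+ 2 by rewrite ltr_pXn2r // nnegrE; lra.
  have kap2 : 0 < kappa ^+ 2 by rewrite exprn_gt0.
  have s0 := sqr_ge0 (i%:R - N%:R + alpha + rho * ((K + k)%N%:R + beta)).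
  move=> hV; apply: lt_le_trans s0.
  by rewrite pmulr_rlt0 //; lra.
have row k : (k < K)%N -> (\sum_(i < 2 * N)
       ((i%:R - N%:R + alpha + rho * (k%:R + beta)) ^+ 2
         <= kappa ^+ 2 * (V ^+ 2 - (k%:R + beta) ^+ 2))%R)%N%:R
   = 2 * kappa * half_chord V (k%:R + beta)
     - psi (- rho * beta - alpha + - rho * k%:R + kappa * Num.sqrt (V ^+ 2 - (k%:R + beta) ^+ 2))
     - psi (rho * beta + alpha + rho * k%:R + kappa * Num.sqrt (V ^+ 2 - (k%:R + beta) ^+ 2)).
  rewrite hK => hv; set v := k%:R + beta in hv *.
  have v0 : 0 <= v by rewrite addr_ge0.
  have vV : v ^+ 2 <= V ^+ 2 by rewrite ler_pXn2r // nnegrE ltW.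
  have h2 : half_chord V v ^+ 2 = V ^+ 2 - v ^+ 2 by rewrite sqr_sqrtr // subr_ge0.
  have h0 : 0 <= half_chord V v by exact: sqrtr_ge0.
  have hle : half_chord V v <= V.
    by rewrite -(@ler_pXn2r _ 2) ?nnegrE ?(ltW V0) // h2; have := sqr_ge0 v; lra.
  rewrite -!/(half_chord V v); set h := half_chord V v in h2 h0 hle *.
  have kh0 : 0 <= kappa * h by rewrite mulr_ge0 // ltW.
  have khV : kappa * h <= kappa * V by rewrite ler_pM2l.
  have rv : `|rho * v| <= `|rho| * V by rewrite normrM (ger0_norm v0) ler_wpM2l.
  move: rv; rewrite ler_norml => /andP[rv1 rv2].
  pose y1 := - (rho * v + alpha + kappa * h).
  pose y2 := - (rho * v + alpha) + kappa * h.
  have := row_count R y1 y2 N ltac:(rewrite /y1 /y2; lra)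
    ltac:(rewrite /y1; lra) ltac:(rewrite /y2; lra).
  have -> : (\sum_(i < 2 * N) (y1 <= i%:R - N%:R <= y2)%R)%N =
    (\sum_(i < 2 * N) ((i%:R - N%:R + alpha + rho * v) ^+ 2 <= kappa ^+ 2 * (V ^+ 2 - v ^+ 2))%R)%N.
    apply: eq_bigr => i _; congr nat_of_bool.
    rewrite -h2 -exprMn -[X in _ = (X <= _)%R]real_normK ?num_real //.
    rewrite ler_pXn2r ?nnegrE // ler_norml.
    by rewrite /y1 /y2; apply/andP/andP => -[h3 h4]; split; lra.
  move=> ->.
  have -> : - rho * beta - alpha + - rho * k%:R + kappa * h = y2.
    by rewrite /y2 /v; ring.
  have -> : rho * beta + alpha + rho * k%:R + kappa * h = - y1.
    by rewrite /y1 /v; ring.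
  by rewrite /y1 /y2; ring.
rewrite natr_sum (eq_bigr _ (fun (k : 'I_K) _ => row k (ltn_ord k))) 2!sumrB -mulr_sumr.
have p1 := psi_circle R V kappa beta w (- rho * beta - alpha) (- rho) K b0 V0 kap w0 wV hK.
have p2 := psi_circle R V kappa beta w (rho * beta + alpha) rho K b0 V0 kap w0 wV hK.
set S1 := \sum_(k < K) psi _ in p1 *; set S2 := \sum_(k < K) psi _ in p2 *.
have -> : 2 * kappa * \sum_(i < K) half_chord V (i%:R + beta) - S1 - S2
   - 2 * kappa * \sum_(k < K) half_chord V (k%:R + beta) = - (S1 + S2) by ring.
rewrite normrN; apply: (le_trans (ler_normD _ _)); lra.
Qed.

Lemma rows_count_le (R : realType) (V beta : R) : 0 < V -> 0 <= beta ->
  exists K : nat, forall k, (k < K)%N = (k%:R + beta <= V).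
Proof.
move=> V0 b0; have [h|h] := leP beta V; last first.
  exists 0%N => k; apply/esym; rewrite ltn0; apply/negbTE; rewrite -ltNge.
  by have : 0 <= k%:R :> R by []; lra.
exists (Num.truncn (V - beta)).+1 => k.
by rewrite ltnS truncn_ge_nat ?subr_ge0 // lerBrDr.
Qed.

(** The lower half is an upper half with [rho] negated and [beta] replaced by [1 - beta]. *)
Lemma ellipse_points (R : realType) (rho kappa V w alpha beta : R) (N : nat) :
  0 < V -> 2^-1 <= kappa -> 0 < w -> w ^+ 3 * V = kappa ->
  0 <= alpha <= 1 -> 0 <= beta <= 1 -> V + (`|rho| + kappa) * V + 3 <= N%:R ->
  `|(\sum_(j < 2 * N) \sum_(i < 2 * N)
       ((i%:R - N%:R + alpha + rho * (j%:R - N%:R + beta)) ^+ 2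
         <= kappa ^+ 2 * (V ^+ 2 - (j%:R - N%:R + beta) ^+ 2))%R)%N%:R
    - pi * kappa * V ^+ 2|
  <= 36 + 16 * circle_const * (w * V) + 24 * kappa * Num.sqrt V.
Proof.
move=> V0 kap w0 wV hal hbe NV.
have /andP[b0 b1] := hbe.
have hbe' : 0 <= 1 - beta <= 1 by lra.
have b0' : 0 <= 1 - beta by lra.
have [K hK] := rows_count_le R V beta V0 b0.
have [K' hK'] := rows_count_le R V (1 - beta) V0 b0'.
have h1 := half_ellipse_points R rho kappa V w alpha beta N K V0 kap w0 wV hal hbe NV hK.
have h2 := half_ellipse_points R (- rho) kappa V w alpha (1 - beta) N K' V0 kap w0 wV hal hbe'.
rewrite normrN in h2; have {}h2 := h2 NV hK'.
have -> : (\sum_(j < 2 * N) \sum_(i < 2 * N)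
       ((i%:R - N%:R + alpha + rho * (j%:R - N%:R + beta)) ^+ 2
         <= kappa ^+ 2 * (V ^+ 2 - (j%:R - N%:R + beta) ^+ 2))%R)%N
  = ((\sum_(k < N) \sum_(i < 2 * N)
       ((i%:R - N%:R + alpha + - rho * (k%:R + (1 - beta))) ^+ 2
         <= kappa ^+ 2 * (V ^+ 2 - (k%:R + (1 - beta)) ^+ 2))%R)
   + \sum_(k < N) \sum_(i < 2 * N)
       ((i%:R - N%:R + alpha + rho * (k%:R + beta)) ^+ 2
         <= kappa ^+ 2 * (V ^+ 2 - (k%:R + beta) ^+ 2))%R)%N.
  rewrite mul2n -addnn big_split_ord /=; congr (_ + _)%N.
    (* Row [- (k + 1) + beta] is the reflection of row [k + (1 - beta)]. *)
    rewrite (reindex_inj rev_ord_inj); apply: eq_bigr => k _ /=.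
    apply: eq_bigr => i _; congr nat_of_bool; rewrite natrB ?ltn_ord //.
    rewrite -[k.+1%:R]natr1.
    have -> : N%:R - (k%:R + 1) - N%:R + beta = - (k%:R + (1 - beta)) :> R by ring.
    by rewrite sqrrN mulrN mulNr.
  apply: eq_bigr => k _; apply: eq_bigr => i _.
  by have -> : (N + k)%N%:R - N%:R = k%:R :> R by rewrite natrD; ring.
rewrite natrD.
set P := (\sum_(k < N) _)%N%:R in h2 *; set P' := (\sum_(k < N) _)%N%:R in h1 *.
set S := \sum_(k < K) _ in h1; set S' := \sum_(k < K') _ in h2.
suff : `|S + S' - pi * V ^+ 2 / 2| <= 12 * Num.sqrt V.
  have kap0 : 0 < 2 * kappa by lra.
  rewrite -(ler_pM2l kap0) => h3.
  have -> : P + P' - pi * kappa * V ^+ 2 = (P - 2 * kappa * S') + (P' - 2 * kappa * S)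
      + 2 * kappa * (S + S' - pi * V ^+ 2 / 2) by field.
  apply: (le_trans (ler_normD _ _)); rewrite [in leLHS]normrM (gtr0_norm kap0).
  have := ler_normD (P - 2 * kappa * S') (P' - 2 * kappa * S); lra.
have [V1|V1] := leP 1 V.
  have a1 := half_circle_sum R V beta K V1 hbe hK.
  have a2 := half_circle_sum R V (1 - beta) K' V1 hbe' hK'.
  (* Both halves are cut at the same line, half a unit below row [beta], so the cut-off areas cancel
     and [2 * area V V] remains. *)
  have e : area V (1 - beta - 2^-1) = - area V (beta - 2^-1).
    have -> : 1 - beta - 2^-1 = - (beta - 2^-1) by field.
    by rewrite area_N //; apply/andP; split; lra.
  rewrite e area_V // in a2; rewrite area_V // in a1.
  rewrite -/S in a1; rewrite -/S' in a2; move: a1 a2; rewrite !ler_norml.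
  by move=> /andP[a1 a2] /andP[a3 a4]; apply/andP; split; lra.
(* For [V < 1] each half has at most one row, and everything is [O(V)], hence [O(sqrt V)]. *)
have one (b : R) (L : nat) : 0 <= b -> (forall k, (k < L)%N = (k%:R + b <= V)) ->
    0 <= \sum_(k < L) half_chord V (k%:R + b) <= V.
  move=> bb hL; have L1 : (L <= 1)%N.
    by rewrite leqNgt hL -ltNge; lra.
  have hb (k : R) : 0 <= half_chord V k <= V.
    rewrite sqrtr_ge0 /= -[leRHS]ger0_norm ?(ltW V0) // -sqrtr_sqr ler_wsqrtr //.
    by have := sqr_ge0 k; lra.
  case: L L1 {hL} => [|[|//]] _; first by rewrite big_ord0 lexx ltW.
  by rewrite big_ord1.
have /andP[s1 s2] := one _ _ b0 hK. have /andP[s3 s4] := one _ _ b0' hK'.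
rewrite -/S in s1 s2; rewrite -/S' in s3 s4.
have r2 : Num.sqrt V ^+ 2 = V by rewrite sqr_sqrtr // ltW.
have r0 : 0 < Num.sqrt V by rewrite sqrtr_gt0.
have r1 : Num.sqrt V <= 1 by rewrite -[leRHS]sqrtr1 ler_wsqrtr // ltW.
have Vr : V <= Num.sqrt V.
  by rewrite -{1}r2 expr2 ler_piMr // ltW.
have pi4 : pi <= 4 :> R by have := pihalf_lt2 R; lra.
have pi0 : 0 <= pi :> R by exact: pi_ge0.
have V2 : V ^+ 2 <= V by rewrite expr2 ler_piMr // ltW.
have V20 : 0 <= V ^+ 2 by exact: sqr_ge0.
have pV : 0 <= pi * V ^+ 2 <= 4 * V.
  by rewrite mulr_ge0 //=; apply: ler_pM.
case/andP: pV => pV0 pV1.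
by rewrite ler_norml; apply/andP; split; lra.
Qed.

(** * Zeros of a form modulo a squarefree integer *)

Definition zeros_mod (f : bqf) (l : nat) : nat :=
  (\sum_(u < l) \sum_(v < l) (l %| qeval f u%:Z v%:Z)%Z)%N.

Lemma dvd_qeval_shift (f : bqf) (m x y s t : int) :
  (m %| qeval f (x + m * s) (y + m * t))%Z = (m %| qeval f x y)%Z.
Proof.
have -> : qeval f (x + m * s) (y + m * t) = qeval f x y +
   m * (qa f * (m * s * s + 2 * s * x) + qb f * (m * s * t + s * y + t * x)
        + qc f * (m * t * t + 2 * t * y)) by rewrite /qeval; ring.
by rewrite rpredDr // dvdz_mulr.
Qed.

Lemma dvd_qeval_mod (f : bqf) (m : nat) (u v : nat) :
  (m %| qeval f u%:Z v%:Z)%Z = (m %| qeval f (u %% m)%N%:Z (v %% m)%N%:Z)%Z.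
Proof.
rewrite {1}(divn_eq u m) {1}(divn_eq v m) !PoszD !PoszM.
by rewrite ![_ * m%:Z]mulrC ![m%:Z * _ + _]addrC dvd_qeval_shift.
Qed.

Lemma sum_crt (m n : nat) (G : nat -> nat -> nat) : coprime m n ->
  (\sum_(u < m * n) G (u %% m) (u %% n) = \sum_(i < m) \sum_(j < n) G i j)%N.
Proof.
move=> cmn; have [->|m0] := posnP m; first by rewrite mul0n !big_ord0.
have [->|n0] := posnP n.
  by rewrite muln0 big_ord0 big1 // => i _; rewrite big_ord0.
pose h (u : 'I_(m * n)) : 'I_m * 'I_n :=
  (Ordinal (ltn_pmod u m0), Ordinal (ltn_pmod u n0)).
have hinj : injective h.
  move=> u v [e1 e2]; apply: val_inj => /=.
  have : u == v %[mod m * n] by rewrite chinese_remainder // e1 e2 !eqxx.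
  by rewrite !modn_small ?ltn_ord // => /eqP.
have hbij : bijective h.
  by apply: inj_card_bij => //; rewrite card_prod !card_ord.
by rewrite pair_big /= (reindex h) /=; [|exact: onW_bij].
Qed.

Lemma zeros_mod_coprime (f : bqf) (m n : nat) : coprime m n ->
  zeros_mod f (m * n) = (zeros_mod f m * zeros_mod f n)%N.
Proof.
move=> cmn; rewrite /zeros_mod.
pose Z (l u v : nat) : nat := (l %| qeval f u%:Z v%:Z)%Z.
have split_ind u v : Z (m * n)%N u v = (Z m (u %% m) (v %% m) * Z n (u %% n) (v %% n))%N.
  by rewrite /Z -!dvd_qeval_mod mulnb PoszM Gauss_dvdz.
under eq_bigr => u _ do under eq_bigr => v _ do rewrite -/(Z (m * n)%N u v) split_ind.
under eq_bigr => u _.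
  rewrite (sum_crt m n (fun i j => Z m (u %% m) i * Z n (u %% n) j)%N cmn).
  over.
rewrite (sum_crt m n (fun u u' => \sum_(i < m) \sum_(j < n) Z m u i * Z n u' j)%N cmn).
rewrite big_distrl /=; apply: eq_bigr => u _; rewrite big_distrr /=.
apply: eq_bigr => u' _; rewrite big_distrl /=; apply: eq_bigr => i _.
by rewrite big_distrr.
Qed.

Lemma zeros_mod_swap (a b c : int) (l : nat) :
  zeros_mod (Bqf a b c) l = zeros_mod (Bqf c b a) l.
Proof.
rewrite /zeros_mod exchange_big /=; apply: eq_bigr => u _; apply: eq_bigr => v _.
by congr (nat_of_bool (_ %| _)%Z); rewrite /qeval /=; ring.
Qed.

Lemma sum_eq_op (T : finType) (a : T) : (\sum_(w : T) (w == a))%N = 1%N.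
Proof. by rewrite (bigD1 a) //= eqxx big1 // => i /negbTE ->. Qed.

Lemma Fp_int_eq0 (p : nat) (p_prime : prime p) (z : int) : (p%:Z %| z)%Z = ((z%:~R : 'F_p) == 0).
Proof.
have e (n : nat) : (p %| n)%N = ((n%:R : 'F_p) == 0).
  by rewrite (dvdn_pcharf (pchar_Fp p_prime)).
case: z => n; rewrite dvdzE /=; first exact: e.
by rewrite e NegzE rmorphN oppr_eq0.
Qed.

Lemma Fp_nat_bij (p : nat) (p_prime : prime p) : bijective (fun u : 'I_p => u%:R : 'F_p).
Proof.
apply: inj_card_bij; last by rewrite card_Fp // card_ord.
move=> u v /(congr1 val) /=; rewrite !val_Fp_nat // !modn_small // => h.
exact: val_inj.
Qed.

Lemma sum_Fp (p : nat) (p_prime : prime p) (G : 'F_p -> nat) :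
  (\sum_(u < p) G u%:R = \sum_(x : 'F_p) G x)%N.
Proof. by rewrite [RHS](reindex _ (onW_bij _ (Fp_nat_bij p p_prime))). Qed.

Lemma zeros_mod_Fp (p : nat) (p_prime : prime p) (f : bqf) :
  zeros_mod f p = (\sum_(v : 'F_p) \sum_(u : 'F_p)
    ((qa f)%:~R * u ^+ 2 + (qb f)%:~R * u * v + (qc f)%:~R * v ^+ 2 == 0)%R)%N.
Proof.
rewrite /zeros_mod exchange_big /= -((sum_Fp p p_prime) (fun v => (\sum_(u : 'F_p)
    ((qa f)%:~R * u ^+ 2 + (qb f)%:~R * u * v + (qc f)%:~R * v ^+ 2 == 0)%R)%N)).
apply: eq_bigr => v _; rewrite -((sum_Fp p p_prime) (fun u =>
    ((qa f)%:~R * u ^+ 2 + (qb f)%:~R * u * v%:R + (qc f)%:~R * v%:R ^+ 2 == 0))).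
apply: eq_bigr => u _; rewrite (Fp_int_eq0 p p_prime) /qeval !intrD !intrM.
by [].
Qed.

Lemma kronecker_at_prime (p : nat) (p_prime : prime p) (m : int) :
  kronecker m p = kronecker_prime m p.
Proof.
have p0 := prime_gt0 p_prime.
rewrite /kronecker eqn0Ngt p0 /= primes_prime // big_seq1.
by rewrite logn_prime // eqxx expr1.
Qed.

Lemma Fp_two_neq0 (p : nat) (p_prime : prime p) (p_odd : p != 2%N) : (2 : 'F_p) != 0.
Proof.
have := (Fp_int_eq0 p p_prime) 2; rewrite dvdzE /= => <-.
apply/negP => /(dvdn_leq (isT : 0 < 2)%N).
by rewrite leq_eqVlt (negbTE p_odd) /= ltnNge prime_gt1.
Qed.

Lemma sum_square_roots (p : nat) (p_prime : prime p) (p_odd : p != 2%N) (m : int) :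
  (\sum_(w : 'F_p) (w ^+ 2 == m%:~R)%R)%N%:Z = 1 + kronecker m p.
Proof.
rewrite (kronecker_at_prime p p_prime) /kronecker_prime (Fp_int_eq0 p p_prime).
case: eqP => [->|/eqP m0].
  under eq_bigr => w _ do rewrite sqrf_eq0.
  by rewrite sum_eq_op.
rewrite (negbTE p_odd).
case: existsP => [[y /eqP hy]|none].
  have e : (y%:R : 'F_p) ^+ 2 = m%:~R.
    have : (p%:Z %| y%:Z ^+ 2 - m)%Z by rewrite -eqz_mod_dvd; apply/eqP.
    by rewrite (Fp_int_eq0 p p_prime) intrB rmorphXn /= subr_eq0 => /eqP.
  set x : 'F_p := y%:R in e.
  have x0 : x != 0 by rewrite -sqrf_eq0 e.
  have nx : (x == - x) = false.
    apply/negbTE; rewrite -subr_eq0 opprK -mulr2n -mulr_natl mulf_neq0 //.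
    exact: (Fp_two_neq0 p p_prime p_odd).
  under eq_bigr => w _.
    rewrite -e eqf_sqr (_ : ((w == x) || (w == - x) : nat) = (w == x) + (w == - x))%N.
      over.
    by case: eqP => [->|_] //=; rewrite nx.
  by rewrite big_split /= !sum_eq_op.
rewrite big1 // => w _; apply/eqP; rewrite eqb0; apply/negP => /eqP hw.
apply: none; have [g gK Kg] := (Fp_nat_bij p p_prime).
exists (g w); rewrite eqz_mod_dvd (Fp_int_eq0 p p_prime) intrB rmorphXn /= subr_eq0.
by rewrite -[(g w)%:Z%:~R]/((g w)%:R) Kg hw.
Qed.

(** The substitution [w = 2 a u + b v] turns the equation into [w ^ 2 = disc v ^ 2]. The row [v = 0]
    has one solution and each of the other [p - 1] rows has [1 + chi(p)]. *)
Lemma zeros_mod_odd_unit (p : nat) (p_prime : prime p) (p_odd : p != 2%N) (f : bqf) :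
  ((qa f)%:~R : 'F_p) != 0 ->
  (zeros_mod f p)%:Z = p%:Z * (1 + kronecker (disc f) p) - kronecker (disc f) p.
Proof.
move=> a0; rewrite (zeros_mod_Fp p p_prime).
set a : 'F_p := (qa f)%:~R in a0 *; set b : 'F_p := (qb f)%:~R; set c : 'F_p := (qc f)%:~R.
have dE : (disc f)%:~R = b ^+ 2 - 4 * a * c :> 'F_p.
  by rewrite /disc intrB !intrM.
have a2 : 2 * a != 0 by rewrite mulf_neq0 // (Fp_two_neq0 p p_prime p_odd).
have rowE v : (\sum_(u : 'F_p) (a * u ^+ 2 + b * u * v + c * v ^+ 2 == 0)%R
   = \sum_(w : 'F_p) (w ^+ 2 == (disc f)%:~R * v ^+ 2)%R)%N.
  rewrite [RHS](reindex (fun u => 2 * a * u + b * v)) /=; last first.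
    exists (fun w => (w - b * v) / (2 * a)) => u _ /=.
      by rewrite addrK mulrAC mulfV // mul1r.
    by rewrite mulrCA mulfV // mulr1 subrK.
  apply: eq_bigr => u _; congr nat_of_bool.
  rewrite -[RHS]subr_eq0 dE.
  have -> : (2 * a * u + b * v) ^+ 2 - (b ^+ 2 - 4 * a * c) * v ^+ 2
     = (2 * 2 * a) * (a * u ^+ 2 + b * u * v + c * v ^+ 2) by ring.
  by rewrite !mulf_eq0 (negbTE a0) (negbTE (Fp_two_neq0 p p_prime p_odd)).
under eq_bigr => v _ do rewrite rowE.
have row0 v : v != 0 -> (\sum_(w : 'F_p) (w ^+ 2 == (disc f)%:~R * v ^+ 2)%R
    = \sum_(w : 'F_p) (w ^+ 2 == (disc f)%:~R)%R)%N.
  move=> v0; rewrite (reindex (fun w => v * w)) /=; last first.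
    exists (fun w => w / v) => w _ /=; first by rewrite mulrAC mulfV // mul1r.
    by rewrite mulrCA mulfV // mulr1.
  apply: eq_bigr => w _; congr nat_of_bool; rewrite exprMn mulrC.
  by rewrite (inj_eq (mulIf _)) // expf_neq0.
rewrite (bigD1 0) //= (eq_bigr _ row0) sum_nat_const.
have -> : (\sum_(w : 'F_p) (w ^+ 2 == (disc f)%:~R * 0 ^+ 2)%R = 1)%N.
  under eq_bigr => w _ do rewrite expr0n mulr0 sqrf_eq0.
  exact: sum_eq_op.
have -> : #|[pred i : 'F_p | i != 0]| = p.-1 by rewrite cardC1 card_Fp.
rewrite PoszD PoszM (sum_square_roots p p_prime p_odd).
have -> : (p.-1)%:Z = p%:Z - 1 by have := prime_gt0 p_prime; lia.
ring.
Qed.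

Lemma int_parity (z : int) : exists k : int, exists e : bool,
  z = 2 * k + e%:Z /\ (2 %| z)%Z = ~~ e.
Proof.
have h1 := divz_eq z 2; have h2 := @modz_ge0 z 2 isT; have h3 := @ltz_pmod z 2 isT.
exists (z %/ 2)%Z; rewrite (_ : (2 %| z)%Z = ((z %% 2)%Z == 0)); last first.
  by rewrite -[dvdz 2]/(dvdz 2%:Z); apply/idP/eqP => [/dvdz_mod0P|/dvdz_mod0P].
move: h1 h2 h3; set q := (z %/ 2)%Z; set r := (z %% 2)%Z => h1 h2 h3.
have [e|e] : r = 0 \/ r = 1 by lia.
  by exists false; rewrite e; split=> //; lia.
by exists true; rewrite e; split=> //; lia.
Qed.

(** Checked on the values 0, [c], [a], [a + b + c]. For even [b] the symbol vanishes; for odd [b]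
    the discriminant is 1 or 5 modulo 8 according to the parity of [a c]. *)
Lemma zeros_mod_two (f : bqf) : primitive f ->
  (zeros_mod f 2)%:Z = 2 * (1 + kronecker (disc f) 2) - kronecker (disc f) 2.
Proof.
case: f => a b c prim; rewrite kronecker_at_prime //.
have ev : ~~ [&& (2 %| a)%Z, (2 %| b)%Z & (2 %| c)%Z].
  apply/negP => /and3P[ha hb hc]; move: prim; rewrite /primitive /= => g1.
  have : (2 %| gcdz (gcdz a b) c)%Z by rewrite !dvdz_gcd ha hb hc.
  by rewrite g1.
have -> : zeros_mod (Bqf a b c) 2
    = (((2 %| 0)%Z + (2 %| c)%Z) + ((2 %| a)%Z + (2 %| (a + b + c)%R)%Z))%N.
  have q00 : qeval (Bqf a b c) 0%N 0%N = 0 by rewrite /qeval /=; ring.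
  have q01 : qeval (Bqf a b c) 0%N 1%N = c by rewrite /qeval /=; ring.
  have q10 : qeval (Bqf a b c) 1%N 0%N = a by rewrite /qeval /=; ring.
  have q11 : qeval (Bqf a b c) 1%N 1%N = a + b + c by rewrite /qeval /=; ring.
  by rewrite /zeros_mod !(big_ord_recr, big_ord0) /= !add0n q00 q01 q10 q11.
have [ka [ea [aE ha]]] := int_parity a; have [kb [eb [bE hb]]] := int_parity b.
have [kc [ec [cE hc]]] := int_parity c; have [ks [es [sE hs]]] := int_parity (a + b + c).
have [kp [ep [pE hp]]] := int_parity (a * c).
have {}hp : ~~ ep = ~~ ea || ~~ ec by rewrite -hp -ha -hc !dvdzE abszM Euclid_dvdM.
(* A product of consecutive integers is even, so the square of an odd [b] is [8 t + 1]. *)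
have [t kt] : exists t, kb * (kb + 1) = 2 * t.
  have [k [[] [kE _]]] := int_parity kb.
    have -> : kb + 1 = 2 * (k + 1) by move: kE; clear; lia.
    by exists (kb * (k + 1)); ring.
  have kE' : kb = 2 * k by move: kE; clear; lia.
  by exists (k * (kb + 1)); rewrite {1}kE'; ring.
have esE : ks * 2 + es%:Z = 2 * (ka + kb + kc) + ea%:Z + eb%:Z + ec%:Z by lia.
rewrite /kronecker_prime /disc /= ha hc hs.
rewrite ha hb hc in ev.
case: eb bE hb ev esE => bE hb ev esE; last first.
  have {}bE : b = 2 * kb by move: bE; clear; lia.
  have -> : (2 %| b ^+ 2 - 4 * a * c)%Z.
    by rewrite bE expr2; apply/dvdzP; exists (2 * kb * kb - 2 * a * c); ring.
  by move: ev esE; clear; case: ea; case: ec; case: es => //=; lia.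
have {}bE : b = 2 * kb + 1 by move: bE; clear; lia.
have dE : b ^+ 2 - 4 * a * c = 8 * (t - kp) + 1 - 4 * ep%:Z.
  have -> : 8 * (t - kp) = 4 * (kb * (kb + 1)) - 8 * kp by rewrite kt; ring.
  have -> : b ^+ 2 - 4 * a * c = b ^+ 2 - 4 * (a * c) by ring.
  by rewrite bE pE; ring.
move: dE; set m := b ^+ 2 - 4 * a * c => dE.
have -> : (2 %| m)%Z = false.
  by apply/negbTE/negP => /dvdzP[h]; rewrite dE; clear; lia.
case: ep pE hp dE => pE hp dE.
  have -> : (m == 1 %[mod 8])%Z = false.
    by apply/negbTE/negP; rewrite eqz_mod_dvd => /dvdzP[h]; rewrite dE; clear; lia.
  have -> : (m == 7 %[mod 8])%Z = false.
    by apply/negbTE/negP; rewrite eqz_mod_dvd => /dvdzP[h]; rewrite dE; clear; lia.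
  by move: hp esE; clear; case: ea; case: ec; case: es => //=; lia.
have -> : (m == 1 %[mod 8])%Z.
  by rewrite eqz_mod_dvd; apply/dvdzP; exists (t - kp); rewrite dE; clear; lia.
by move: hp esE; clear; case: ea; case: ec; case: es => //=; lia.
Qed.

Lemma zeros_mod_odd (p : nat) (p_prime : prime p) (f : bqf) : primitive f -> p != 2%N ->
  (zeros_mod f p)%:Z = p%:Z * (1 + kronecker (disc f) p) - kronecker (disc f) p.
Proof.
move=> prim p2.
have [a0|] := eqVneq ((qa f)%:~R : 'F_p) 0; last exact: zeros_mod_odd_unit.
case: f prim a0 => a b c prim /= a0.
have [c0|c0] := eqVneq ((c)%:~R : 'F_p) 0; last first.
  rewrite zeros_mod_swap (zeros_mod_odd_unit p p_prime p2) //.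
  have -> // : disc (Bqf c b a) = disc (Bqf a b c) by rewrite /disc /=; ring.
(* The form is now [b u v] modulo [p], with [b] a unit by primitivity: the discriminant is a nonzero
   square and there are [2 p - 1] zeros, on the two axes. *)
have b0 : (b%:~R : 'F_p) != 0.
  rewrite -(Fp_int_eq0 p p_prime); apply/negP => hb.
  have ha : (p %| a)%Z by rewrite (Fp_int_eq0 p p_prime) a0.
  have hc : (p %| c)%Z by rewrite (Fp_int_eq0 p p_prime) c0.
  have : (p %| gcdz (gcdz a b) c)%Z by rewrite !dvdz_gcd ha hb hc.
  rewrite prim dvdzE /= dvdn1 => /eqP p1; by rewrite p1 in p_prime.
have dE : (disc (Bqf a b c))%:~R = (b%:~R : 'F_p) ^+ 2.
  by rewrite /disc /= intrB !intrM a0 mulr0 mul0r subr0.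
have chi1 : kronecker (disc (Bqf a b c)) p = 1.
  have := sum_square_roots p p_prime p2 (disc (Bqf a b c)).
  rewrite dE; set x : 'F_p := b%:~R in b0 *.
  have nx : (x == - x) = false.
    apply/negbTE; rewrite -subr_eq0 opprK -mulr2n -mulr_natl mulf_neq0 //.
    exact: Fp_two_neq0.
  under eq_bigr => w _.
    rewrite eqf_sqr (_ : ((w == x) || (w == - x) : nat) = (w == x) + (w == - x))%N.
      over.
    by case: eqP => [->|_] //=; rewrite nx.
  rewrite big_split /= !sum_eq_op => h; apply: (@addrI _ 1); rewrite -h; done.
rewrite chi1 (zeros_mod_Fp p p_prime) /= a0 c0.
rewrite (bigD1 0) //=.
have -> : (\sum_(u : 'F_p) (0 * u ^+ 2 + b%:~R * u * 0 + 0 * 0 ^+ 2 == 0)%R = p)%N.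
  under eq_bigr => u _ do rewrite !mul0r mulr0 !addr0 eqxx.
  by rewrite sum1_card card_Fp.
rewrite (eq_bigr (fun=> 1%N)); last first.
  move=> v v0; under eq_bigr => u _.
    rewrite !mul0r add0r addr0 !mulf_eq0 (negbTE b0) (negbTE v0) orbF /=.
    over.
  exact: sum_eq_op.
rewrite sum1_card (_ : #|_| = p.-1); last by rewrite cardC1 card_Fp.
by have := prime_gt0 p_prime; lia.
Qed.

Lemma zeros_mod_prime (p : nat) (p_prime : prime p) (f : bqf) : primitive f ->
  (zeros_mod f p)%:Z = p%:Z * (1 + kronecker (disc f) p) - kronecker (disc f) p.
Proof.
have [->|p2] := eqVneq p 2%N; first exact: zeros_mod_two.
by move=> prim; apply: zeros_mod_odd.
Qed.

Lemma zeros_mod_prime_le (p : nat) (p_prime : prime p) (f : bqf) : primitive f ->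
  (zeros_mod f p <= 2 * p)%N.
Proof.
move=> /(zeros_mod_prime p p_prime f).
have : kronecker (disc f) p \in [:: 0; 1; -1].
  rewrite (kronecker_at_prime p p_prime) /kronecker_prime.
  by do !case: ifP => _; rewrite !inE eqxx ?orbT.
rewrite !inE => /or3P[]/eqP->; have := prime_gt0 p_prime; clear; lia.
Qed.

Lemma num_divisors_prime_mul (p m : nat) : prime p -> (0 < m)%N -> coprime p m ->
  (2 * num_divisors m <= num_divisors (p * m))%N.
Proof.
move=> p_prime m0 cpm; have p0 := prime_gt0 p_prime.
have -> : (2 * num_divisors m)%N = size (divisors m ++ [seq (p * d)%N | d <- divisors m]).
  by rewrite size_cat size_map mul2n addnn.
apply: uniq_leq_size.
  rewrite cat_uniq divisors_uniq map_inj_uniq ?divisors_uniq ?andbT /=; last first.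
    by move=> x y /eqP; rewrite eqn_pmul2l // => /eqP.
  apply/hasPn => _ /mapP[d hd ->]; rewrite -dvdn_divisors //.
  apply/negP => /(dvdn_trans (dvdn_mulr d (dvdnn p))) pm.
  by move: cpm; rewrite prime_coprime // pm.
move=> d; rewrite mem_cat -!dvdn_divisors ?muln_gt0 ?p0 //.
case/orP => [|/mapP[e he ->]]; first by move=> h; apply: dvdn_mull.
by rewrite dvdn_pmul2l // dvdn_divisors.
Qed.

(** Prime factors are split off one at a time; each multiplies the number of zeros by at most [2 p],
    and the factor 2 is paid for by the doubling of the number of divisors. *)
Lemma zeros_mod_squarefree (R : realType) (f : bqf) (g : nat -> R) (l : nat) :
  primitive f -> multiplicative_fun g ->
  (forall p : nat, prime p ->
       g p = p%:R^-1 * (1 + (kronecker (disc f) p)%:~R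
                          - (kronecker (disc f) p)%:~R / p%:R)) ->
  (1 <= l)%N -> squarefree l ->
  (zeros_mod f l)%:R = l%:R ^+ 2 * g l /\ (zeros_mod f l <= num_divisors l * l)%N.
Proof.
move=> prim [g1 gM] gp; have [n] := ubnP l; elim: n l => // n IH l ln l1 sqf.
have [l1'|lgt1] := leqP l 1.
  have -> : l = 1%N by apply/eqP; rewrite eqn_leq l1' l1.
  split; last by rewrite /zeros_mod !big_ord1 dvd1z.
  by rewrite /zeros_mod !big_ord1 dvd1z g1 expr1n mulr1.
have p_prime := pdiv_prime lgt1; set p := pdiv l in p_prime.
have p0 := prime_gt0 p_prime.
have lE : l = (p * (l %/ p))%N by rewrite mulnC divnK // pdiv_dvd.
set m := (l %/ p)%N in lE.
have m0 : (0 < m)%N by rewrite lt0n; apply: contraTneq lgt1 => m0; rewrite lE m0 muln0.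
have cpm : coprime p m.
  rewrite prime_coprime //; apply/negP => pm.
  have p1 : p = 1%N by apply: sqf; rewrite lE expnS expn1 dvdn_pmul2l.
  by rewrite p1 in p_prime.
have sqm : squarefree m.
  by move=> d hd; apply: sqf; rewrite lE; apply: dvdn_mull.
have mn : (m < n)%N.
  have : (m < l)%N by rewrite lE -{1}[m]mul1n ltn_pmul2r // prime_gt1.
  by move=> h; rewrite -ltnS (leq_ltn_trans h).
have [e1 e2] := IH m mn m0 sqm.
have zp := zeros_mod_prime p p_prime f prim.
have zp2 := zeros_mod_prime_le p p_prime f prim.
have nd := num_divisors_prime_mul p m p_prime m0 cpm.
have pR : (p%:R : R) != 0 by rewrite pnatr_eq0 -lt0n.
rewrite lE zeros_mod_coprime //; split.
  rewrite !natrM e1 gM // (gp p p_prime).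
  have -> : (zeros_mod f p)%:R = p%:R * (1 + (kronecker (disc f) p)%:~R)
      - (kronecker (disc f) p)%:~R :> R.
    by move/(congr1 (fun z : int => z%:~R : R)): zp; rewrite intrB intrM intrD.
  by move: pR; move: (p%:R : R) => q q0; field.
apply: (leq_trans (leq_mul zp2 e2)).
have -> : (2 * p * (num_divisors m * m) = 2 * num_divisors m * (p * m))%N by ring.
by rewrite leq_mul2r nd orbT.
Qed.

(** * Representation numbers and congruence classes *)

Lemma rep_count_box (f : bqf) (n N : nat) :
  (forall u v, qeval f u v = n%:Z -> (- N%:Z <= u < N%:Z) && (- N%:Z <= v < N%:Z)) ->
  rep_count f n = (\sum_(k < 2 * N) \sum_(h < 2 * N)
     (qeval f (k%:Z - N%:Z)%R (h%:Z - N%:Z)%R == n%:Z))%N.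
Proof.
move=> box; rewrite /rep_count.
pose rg := [seq (k%:Z - N%:Z)%R | k <- iota 0 (2 * N)].
have rgP u : (u \in rg) = (- N%:Z <= u < N%:Z).
  apply/mapP/idP => [[k]|hu]; first by rewrite mem_iota => hk ->; move: hk; clear; lia.
  exists (absz (u + N%:Z)); first by rewrite mem_iota; move: hu; clear; lia.
  by move: hu; clear; lia.
have rg_uniq : uniq rg by rewrite map_inj_uniq ?iota_uniq // => x y; clear; lia.
pose s : seq (int * int) := [seq uv <- [seq (u, v) | u <- rg, v <- rg] | qeval f uv.1 uv.2 == n%:Z].
have su : uniq s.
  by rewrite filter_uniq // allpairs_uniq // => -[a b] [c d] _ _ [-> ->].
have -> : [set uv : int * int | qeval f uv.1 uv.2 = n%:Z]%classic
    = [set` [fset x in s]%fset]%classic.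
  apply/seteqP; split=> [[u v] /= e|[u v]] /=.
    rewrite !inE mem_filter /= e eqxx /=; apply/allpairsP; exists (u, v) => /=.
    by rewrite !rgP; case/andP: (box u v e).
  by rewrite !inE mem_filter /= => /andP[/eqP].
rewrite set_fsetK card_fseq undup_id // size_filter -sum1_count big_mkcond /=.
have iotaE : iota 0 (2 * N) = index_iota 0 (2 * N) by rewrite /index_iota subn0.
rewrite big_allpairs /rg big_map iotaE big_mkord; apply: eq_bigr => k _.
by rewrite big_map big_mkord; apply: eq_bigr => h _ /=; case: eqP.
Qed.

Lemma rep_count_zero (f : bqf) : posdef f -> rep_count f 0 = 1%N.
Proof.
case=> dneg a0; rewrite /rep_count.
have -> : [set uv : int * int | qeval f uv.1 uv.2 = 0%:Z]%classic = [set (0, 0)]%classic.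
  apply/seteqP; split=> [[u v] /= e|[u v] /= [-> ->]]; last by rewrite /qeval; ring.
  have h : (2 * qa f * u + qb f * v) ^+ 2 + (- disc f) * v ^+ 2 = 0.
    have -> : (2 * qa f * u + qb f * v) ^+ 2 + (- disc f) * v ^+ 2 = 4 * qa f * qeval f u v.
      by rewrite /qeval /disc; ring.
    by rewrite e mulr0.
  have dv : 0 <= - disc f * v ^+ 2 by apply: mulr_ge0 (sqr_ge0 v); rewrite oppr_ge0 ltW.
  move/eqP: h; rewrite paddr_eq0 ?sqr_ge0 //.
  case/andP=> h1 h2.
  have v0 : v = 0.
    by move: h2; rewrite mulf_eq0 oppr_eq0 (lt_eqF dneg) /= sqrf_eq0 => /eqP.
  move: h1; rewrite v0 mulr0 addr0 sqrf_eq0 !mulf_eq0 (gt_eqF a0) /= => /eqP ->.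
  by [].
by rewrite fset_set1 cardfs1.
Qed.

Lemma qeval_ge0 (f : bqf) (u v : int) : posdef f -> 0 <= qeval f u v.
Proof.
case=> dneg a0; have h : 0 < 4 * qa f by rewrite mulr_gt0.
rewrite -(pmulr_rge0 _ h).
have -> : 4 * qa f * qeval f u v = (2 * qa f * u + qb f * v) ^+ 2 + (- disc f) * v ^+ 2.
  by rewrite /qeval /disc; ring.
by rewrite addr_ge0 ?sqr_ge0 //; apply: mulr_ge0 (sqr_ge0 v); rewrite oppr_ge0 ltW.
Qed.

(** The successor accounts for [n = 0], represented only by the origin; with it the left side counts
    all lattice points of the ellipse with [l] dividing the value. *)
Lemma sum_rep_count (f : bqf) (l T N : nat) : posdef f -> (0 < l)%N ->
  (forall u v, qeval f u v <= T%:Z ->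
     (- (N * l)%N%:Z <= u < (N * l)%N%:Z) && (- (N * l)%N%:Z <= v < (N * l)%N%:Z)) ->
  ((\sum_(1 <= n < T.+1 | (l %| n)%N) rep_count f n).+1 =
  \sum_(u < l) \sum_(v < l) (l %| qeval f u%:Z v%:Z)%Z *
    \sum_(j < 2 * N) \sum_(i < 2 * N)
      (qeval f (u%:Z + l%:Z * (i%:Z - N%:Z)) (v%:Z + l%:Z * (j%:Z - N%:Z)) <= T%:Z)%R)%N.
Proof.
move=> pd l0 box.
(* Taking the side of the box as a multiple of [l] keeps residues intact when coordinates are
   shifted to be nonnegative. *)
pose M := (N * l)%N.
transitivity (\sum_(0 <= n < T.+1 | (l %| n)%N) rep_count f n)%N.
  by rewrite [RHS]big_ltn_cond //= dvdn0 rep_count_zero.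
rewrite big_mkord.
have cnt (u v : int) : (\sum_(n < T.+1 | (l %| n)%N) (qeval f u v == n%:Z))%N
    = ((l %| qeval f u v)%Z && (qeval f u v <= T%:Z)%R)%N.
  have := qeval_ge0 f u v pd; case: (qeval f u v) => // q _.
  rewrite dvdzE /= lez_nat; case: (leqP q T) => qT; last first.
    rewrite andbF big1 // => n _; apply/eqP; rewrite eqb0; apply/negP => /eqP[e].
    by have := ltn_ord n; rewrite -e ltnS leqNgt qT.
  rewrite andbT big_mkcond (bigD1 (Ordinal (qT : q < T.+1)%N)) //= eqxx big1 ?addn0.
    by case: (l %| q)%N.
  move=> n nq; case: ifP => // _; apply/eqP; rewrite eqb0; apply: contra nq => /eqP[e].
  by apply/eqP/val_inj.
have -> : (\sum_(n < T.+1 | (l %| n)%N) rep_count f n)%N =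
   (\sum_(k < 2 * M) \sum_(h < 2 * M)
      ((l %| qeval f (k%:Z - M%:Z)%R (h%:Z - M%:Z)%R)%Z &&
       (qeval f (k%:Z - M%:Z) (h%:Z - M%:Z) <= T%:Z)%R))%N.
  rewrite (eq_bigr (fun n : 'I_T.+1 => \sum_(k < 2 * M) \sum_(h < 2 * M)
     (qeval f (k%:Z - M%:Z)%R (h%:Z - M%:Z)%R == n%:Z)))%N; last first.
    move=> n _; apply: rep_count_box => u v e; apply: box.
    by rewrite e lez_nat -ltnS.
  rewrite exchange_big /=; apply: eq_bigr => k _.
  by rewrite exchange_big /=; apply: eq_bigr => h _; rewrite cnt.
have -> : (2 * M = 2 * N * l)%N by rewrite /M mulnA.
rewrite (sum_blocks _ (fun k => \sum_(h < 2 * N * l)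
      ((l %| qeval f (k%:Z - M%:Z)%R (h%:Z - M%:Z)%R)%Z &&
       (qeval f (k%:Z - M%:Z) (h%:Z - M%:Z) <= T%:Z)%R))%N) exchange_big /=.
apply: eq_bigr => u _.
under eq_bigr => i _.
  rewrite (sum_blocks _ (fun h => ((l %| qeval f ((i * l + u)%N%:Z - M%:Z)%R (h%:Z - M%:Z)%R)%Z &&
       (qeval f ((i * l + u)%N%:Z - M%:Z) (h%:Z - M%:Z) <= T%:Z)%R) : nat)).
  over.
rewrite exchange_big /=.
under eq_bigr => j _ do rewrite exchange_big /=.
rewrite exchange_big /=; apply: eq_bigr => v _.
rewrite big_distrr /=; apply: eq_bigr => j _.
rewrite big_distrr /=; apply: eq_bigr => i _.
have shift (s t : nat) : (s * l + t)%N%:Z - M%:Z = t%:Z + l%:Z * (s%:Z - N%:Z).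
  by rewrite PoszD PoszM /M PoszM; ring.
by rewrite !shift dvd_qeval_shift mulnb.
Qed.

(** * One congruence class, and the assembly of the theorem *)

Lemma powR_expn (R : realType) (y r : R) (n : nat) : 0 <= y ->
  (y `^ r) ^+ n = y `^ (r * n%:R).
Proof. by move=> y0; rewrite -powR_mulrn ?powR_ge0 // powRrM. Qed.

(** Division of [4 a f = (2 a u + b v) ^ 2 + D v ^ 2] by [4 a ^ 2 l ^ 2] gives the ellipse of
    [ellipse_points] with [rho = b / (2 a)]. The fractional powers are compared by raising both
    sides to the third or fourth power. *)
Lemma class_count (R : realType) (f : bqf) (D : int) (l : nat) (x : R) (u v N : nat) :
  posdef f -> disc f = - D -> qa f ^+ 2 <= D -> (0 < l)%N -> (u < l)%N -> (v < l)%N ->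
  D%:~R <= x ->
  let V := Num.sqrt (4 * (qa f)%:~R * x / (l%:R ^+ 2 * D%:~R)) in
  let kappa := Num.sqrt D%:~R / (2 * (qa f)%:~R) in
  V + (`|(qb f)%:~R / (2 * (qa f)%:~R)| + kappa) * V + 3 <= N%:R ->
  `|(\sum_(j < 2 * N) \sum_(i < 2 * N)
      (qeval f (u%:Z + l%:Z * (i%:Z - N%:Z)) (v%:Z + l%:Z * (j%:Z - N%:Z))
        <= (Num.truncn x)%:Z)%R)%N%:R
    - 2 * pi / Num.sqrt D%:~R * x / l%:R ^+ 2|
  <= (36 + 32 * circle_const) * (x `^ (1 / 3) / (D%:~R `^ (1 / 6))) +
     24 * (D%:~R `^ (3 / 4) / ((qa f)%:~R `^ (7 / 4)) * x `^ (1 / 4)).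
Proof.
move=> pd dD aD l0 ul vl Dx V kappa NV.
have [_ a0] := pd.
have lR : (0 : R) < l%:R by rewrite ltr0n.
have l1 : (1 : R) <= l%:R by rewrite (ler_nat _ 1).
have aR0 : (0 : R) < (qa f)%:~R by rewrite ltr0z.
have aR1 : (1 : R) <= (qa f)%:~R by rewrite ler1z.
have aDR : (qa f)%:~R ^+ 2 <= D%:~R :> R by rewrite -rmorphXn /= ler_int.
have D1 : (1 : R) <= D%:~R by apply: le_trans aDR; rewrite exprn_ege1.
have x1 : 1 <= x by lra.
have DE : D%:~R = 4 * (qa f)%:~R * (qc f)%:~R - (qb f)%:~R ^+ 2 :> R.
  have -> : D = 4 * qa f * qc f - qb f ^+ 2 by rewrite -[D]opprK -dD /disc; ring.
  by rewrite intrB !intrM.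
have bigE (y z : R) :
   4 * (qa f)%:~R * ((qa f)%:~R * y ^+ 2 + (qb f)%:~R * y * z + (qc f)%:~R * z ^+ 2)
   = (2 * (qa f)%:~R * y + (qb f)%:~R * z) ^+ 2 + D%:~R * z ^+ 2.
  by rewrite DE; ring.
move: NV bigE; rewrite /kappa /V.
clear kappa V.
set a : R := (qa f)%:~R in aR0 aR1 aDR DE *; set b : R := (qb f)%:~R in DE *.
set c : R := (qc f)%:~R in DE *; set Dr : R := D%:~R in aDR D1 DE Dx *.
set V := Num.sqrt (4 * _ * _ / _); set kappa := Num.sqrt _ / (2 * a).
move=> NV bigE.
have Drp : 0 < Dr by lra.
have sD0 : 0 < Num.sqrt Dr by rewrite sqrtr_gt0; lra.
have sD2 : Num.sqrt Dr ^+ 2 = Dr by rewrite sqr_sqrtr; lra.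
have l2 : 0 < l%:R ^+ 2 :> R by rewrite exprn_gt0.
have Varg : 0 < 4 * a * x / (l%:R ^+ 2 * Dr).
  by rewrite divr_gt0 // !mulr_gt0 //; lra.
have V0 : 0 < V by rewrite sqrtr_gt0.
have V2 : V ^+ 2 = 4 * a * x / (l%:R ^+ 2 * Dr) by rewrite sqr_sqrtr // ltW.
have kap0 : 0 < kappa by apply: divr_gt0 => //; lra.
have kap : 2^-1 <= kappa.
  have : a <= Num.sqrt Dr by rewrite -(@ler_pXn2r _ 2) ?nnegrE ?(ltW sD0) ?(ltW aR0) // sD2.
  move=> h; rewrite /kappa ler_pdivlMr; lra.
have kap2 : kappa ^+ 2 = Dr / (4 * a ^+ 2).
  by rewrite /kappa exprMn sD2; field; rewrite lt0r_neq0.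
pose w := (kappa / V) `^ (1 / 3).
have w0 : 0 < w by rewrite powR_gt0 // divr_gt0.
have w3 : w ^+ 3 = kappa / V.
  have kV : 0 <= kappa / V by rewrite divr_ge0 // ltW.
  have third : 1 / 3 * 3%:R = 1 :> R by field.
  by rewrite /w powR_expn // third powRr1.
have wV : w ^+ 3 * V = kappa by rewrite w3 divfK // lt0r_neq0.
have frac (n : nat) : (n < l)%N -> 0 <= (n%:R / l%:R : R) <= 1.
  move=> nl; apply/andP; split; first exact: divr_ge0.
  by rewrite ler_pdivrMr // mul1r ler_nat ltnW.
have main := ellipse_points R (b / (2 * a)) kappa V w (u%:R / l%:R) (v%:R / l%:R) N
   V0 kap w0 wV (frac u ul) (frac v vl) NV.
have cntE : (\sum_(j < 2 * N) \sum_(i < 2 * N)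
       ((i%:R - N%:R + u%:R / l%:R + b / (2 * a) * (j%:R - N%:R + v%:R / l%:R)) ^+ 2
         <= kappa ^+ 2 * (V ^+ 2 - (j%:R - N%:R + v%:R / l%:R) ^+ 2))%R)%N
  = (\sum_(j < 2 * N) \sum_(i < 2 * N)
      (qeval f (u%:Z + l%:Z * (i%:Z - N%:Z)) (v%:Z + l%:Z * (j%:Z - N%:Z))
        <= (Num.truncn x)%:Z)%R)%N.
  apply: eq_bigr => j _; apply: eq_bigr => i _; congr nat_of_bool.
  set y : R := i%:R - N%:R + u%:R / l%:R; set z : R := j%:R - N%:R + v%:R / l%:R.
  have -> : (qeval f (u%:Z + l%:Z * (i%:Z - N%:Z)) (v%:Z + l%:Z * (j%:Z - N%:Z))
        <= (Num.truncn x)%:Z) =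
     (a * (l%:R * y) ^+ 2 + b * (l%:R * y) * (l%:R * z) + c * (l%:R * z) ^+ 2 <= x).
    have -> : a * (l%:R * y) ^+ 2 + b * (l%:R * y) * (l%:R * z) + c * (l%:R * z) ^+ 2
       = (qeval f (u%:Z + l%:Z * (i%:Z - N%:Z)) (v%:Z + l%:Z * (j%:Z - N%:Z)))%:~R.
      have e (s t : nat) : l%:R * (s%:R - N%:R + t%:R / l%:R) =
          (t%:Z + l%:Z * (s%:Z - N%:Z))%:~R :> R.
        by rewrite intrD intrM intrB -!pmulrn; field; rewrite lt0r_neq0.
      have qR (X Y : int) : (qeval f X Y)%:~R =
          a * X%:~R ^+ 2 + b * X%:~R * Y%:~R + c * Y%:~R ^+ 2 :> R.
        by rewrite /qeval !intrD !intrM.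
      by rewrite /y /z !e qR.
    (* The form takes nonnegative integer values, so comparing it with [x] or with the integer part
       of [x] is the same. *)
    have := qeval_ge0 f (u%:Z + l%:Z * (i%:Z - N%:Z)) (v%:Z + l%:Z * (j%:Z - N%:Z)) pd.
    case: (qeval _ _ _) => // q _; rewrite lez_nat truncn_ge_nat //; lra.
  have p4 : 0 < 4 * a by rewrite mulr_gt0.
  have q4 : 0 < 4 * a ^+ 2 * l%:R ^+ 2 by rewrite !mulr_gt0 // exprn_gt0.
  rewrite -[RHS](ler_pM2l p4) bigE -[LHS](ler_pM2l q4).
  have e1 : 4 * a ^+ 2 * l%:R ^+ 2 * (y + b / (2 * a) * z) ^+ 2
     = (2 * a * (l%:R * y) + b * (l%:R * z)) ^+ 2 by field; rewrite lt0r_neq0.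
  have e2 : 4 * a ^+ 2 * l%:R ^+ 2 * (kappa ^+ 2 * (V ^+ 2 - z ^+ 2))
     = 4 * a * x - Dr * (l%:R * z) ^+ 2.
    by rewrite kap2 V2; field; rewrite !lt0r_neq0.
  by rewrite e1 e2 lerBrDr.
rewrite cntE in main.
have areaE : pi * kappa * V ^+ 2 = 2 * pi / Num.sqrt Dr * x / l%:R ^+ 2.
  rewrite V2 /kappa -{2}sD2; field.
  by rewrite !lt0r_neq0.
rewrite areaE in main; apply: (le_trans main).
have x0 : 0 <= x by exact: le_trans ler01 x1.
have Dr0 : 0 <= Dr by exact: ltW.
set T := x `^ (1 / 3) / _; set Y := _ * x `^ (1 / 4).
have xp : 0 < x by apply: lt_le_trans x1.
have T0 : 0 < T by rewrite /T; apply: divr_gt0; exact: powR_gt0.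
have Y0 : 0 < Y.
  by rewrite /Y; apply: mulr_gt0; [apply: divr_gt0|]; exact: powR_gt0.
have T3 : T ^+ 3 = x / Num.sqrt Dr.
  rewrite /T exprMn exprVn (powR_expn R x) // (powR_expn R Dr) //.
  have -> : 1 / 3 * 3%:R = 1 :> R by field.
  have -> : 1 / 6 * 3%:R = 2^-1 :> R by field.
  by rewrite powRr1 // powR12_sqrt.
have Y4 : Y ^+ 4 = Dr ^+ 3 / a ^+ 7 * x.
  rewrite /Y 2!exprMn exprVn (powR_expn R x) // (powR_expn R Dr) // (powR_expn R a) ?(ltW aR0) //.
  have -> : 3 / 4 * 4%:R = 3%:R :> R by field.
  have -> : 7 / 4 * 4%:R = 7%:R :> R by field.
  have -> : 1 / 4 * 4%:R = 1 :> R by field.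
  by rewrite powRr1 // !powR_mulrn // ltW.
(* The cube of [w V] is [kappa V ^ 2 = (2 / l ^ 2) T ^ 3]. *)
have wVT : w * V <= 2 * T.
  have wV0 : 0 <= w * V by apply: mulr_ge0; exact: ltW.
  have T20 : 0 <= 2 * T by apply: mulr_ge0 => //; exact: ltW.
  rewrite -(@ler_pXn2r _ 3) ?nnegrE //.
  have -> : (w * V) ^+ 3 = (w ^+ 3 * V) * V ^+ 2 by ring.
  rewrite wV exprMn T3.
  have -> : kappa * V ^+ 2 = (2 / l%:R ^+ 2) * (x / Num.sqrt Dr).
    rewrite V2 /kappa -{2}sD2; field.
    by rewrite !lt0r_neq0.
  rewrite ler_pM2r; last by rewrite divr_gt0 //; lra.
  rewrite ler_pdivrMr //.
  have : 1 <= l%:R ^+ 2 :> R by rewrite exprn_ege1.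
  by clear; lra.
have T1 : 1 <= T.
  rewrite -(@ler_pXn2r _ 3) ?nnegrE ?(ltW T0) // expr1n T3 ler_pdivlMr // mul1r.
  have : Num.sqrt Dr <= Dr.
    by rewrite -{2}sD2 expr2 ler_peMl ?(ltW sD0) // -[1]sqrtr1 ler_wsqrtr.
  by move=> /le_trans; apply.
(* The fourth powers are [D x / (4 a ^ 3 l ^ 2)] and [D ^ 3 x / a ^ 7]; their comparison comes down
   to [a ^ 4 <= D ^ 2]. *)
have kVY : kappa * Num.sqrt V <= Y.
  have kV0 : 0 <= kappa * Num.sqrt V by apply: mulr_ge0 (ltW kap0) (sqrtr_ge0 V).
  rewrite -(@ler_pXn2r _ 4) ?nnegrE ?(ltW Y0) //.
  have -> : (kappa * Num.sqrt V) ^+ 4 = (kappa ^+ 2) ^+ 2 * (Num.sqrt V ^+ 2) ^+ 2 by ring.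
  rewrite (sqr_sqrtr (ltW V0)) V2 kap2 Y4.
  have -> : (Dr / (4 * a ^+ 2)) ^+ 2 * (4 * a * x / (l%:R ^+ 2 * Dr))
      = (Dr / a ^+ 7 * x) * (a ^+ 4 / (4 * l%:R ^+ 2)).
    by field; rewrite !lt0r_neq0.
  have -> : Dr ^+ 3 / a ^+ 7 * x = (Dr / a ^+ 7 * x) * Dr ^+ 2 by ring.
  apply: ler_wpM2l; first by rewrite !mulr_ge0 ?invr_ge0 ?exprn_ge0 // ltW.
  rewrite ler_pdivrMr; last by rewrite mulr_gt0.
  have h1 : a ^+ 4 <= Dr ^+ 2.
    by rewrite (_ : a ^+ 4 = (a ^+ 2) ^+ 2) ?ler_pXn2r ?nnegrE ?exprn_ge0 ?(ltW aR0) // -exprM.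
  have h2 : Dr ^+ 2 <= Dr ^+ 2 * (4 * l%:R ^+ 2).
    rewrite ler_peMr ?exprn_ge0 //; have : 1 <= l%:R ^+ 2 :> R by rewrite exprn_ege1.
    by clear; lra.
  by move: h1 h2; clear; lra.
have C1 := circle_const_ge1 R.
have h : 0 <= circle_const * (2 * T - w * V).
  have h0 : 0 <= 2 * T - w * V by rewrite subr_ge0.
  by have := mulr_ge0 (le_trans ler01 C1) h0.
move: h kVY T1 C1; rewrite mulrBr; move: (T) (Y) (w) (V) (kappa) => T' Y' w' V' kappa'; clear; lra.
Qed.

Lemma qeval_box (f : bqf) (t u v : int) : posdef f -> qeval f u v <= t ->
  u ^+ 2 <= 4 * qc f * t /\ v ^+ 2 <= 4 * qa f * t.
Proof.
case=> dneg a0; have Dge1 : 1 <= - disc f by lia.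
have c0 : 0 < qc f.
  have p4 : 0 < 4 * qa f by rewrite mulr_gt0.
  rewrite -(pmulr_rgt0 _ p4); apply: le_lt_trans (sqr_ge0 (qb f)) _.
  by move: dneg; rewrite /disc subr_lt0.
have est (a s w : int) : 0 < a -> 4 * a * qeval f u v = s ^+ 2 + (- disc f) * w ^+ 2 ->
    qeval f u v <= t -> w ^+ 2 <= 4 * a * t.
  move=> pa e ht; have p4 : 0 < 4 * a by rewrite mulr_gt0.
  apply: (@le_trans _ _ (4 * a * qeval f u v)); last by rewrite ler_pM2l.
  rewrite e; apply: (@le_trans _ _ (- disc f * w ^+ 2)).
    by rewrite ler_peMl // sqr_ge0.
  by rewrite lerDr sqr_ge0.
move=> ht; split.
  by apply: (est _ (2 * qc f * v + qb f * u)) => //; rewrite /qeval /disc; ring.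
by apply: (est _ (2 * qa f * u + qb f * v)) => //; rewrite /qeval /disc; ring.
Qed.

Lemma sqr_lt_itv (N z t : int) : 0 < N -> t < N -> z ^+ 2 <= t -> - N <= z < N.
Proof.
move=> N0 tN zt; have h : z ^+ 2 < N ^+ 2.
  apply: (le_lt_trans zt); apply: (lt_le_trans tN).
  by rewrite expr2 ler_peMl // ltW.
have : `|z| < N by rewrite -(@ltr_pXn2r _ 2) ?nnegrE ?(ltW N0) // real_normK ?num_real.
by rewrite ltr_norml => /andP[h1 ->]; rewrite ltW.
Qed.

Lemma main_term_ge1 (R : realType) (D x : R) : 1 <= D -> D <= x ->
  1 <= x `^ (1 / 3) / (D `^ (1 / 6)).
Proof.
move=> D1 Dx; have Dp : 0 < D by lra.
rewrite ler_pdivlMr ?powR_gt0 // (mul1r (D `^ _)).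
apply: (@le_trans _ _ (D `^ (1 / 3))); first by apply: ler_powR; lra.
have h3 : 0 <= 1 / 3 :> R by lra.
by apply: (ge0_ler_powR h3); rewrite ?nnegrE; lra.
Qed.

Theorem theorem1p1 (R : realType) :
  exists C : R, 0 < C /\
  forall (f : bqf) (D : int) (l : nat) (g : nat -> R) (x : R),
    reduced f ->
    disc f = - D ->
    (1 <= l)%N ->
    squarefree l ->
    multiplicative_fun g ->
    (forall p : nat, prime p ->
       g p = p%:R^-1 * (1 + (kronecker (- D) p)%:~R
                          - (kronecker (- D) p)%:~R / p%:R)) ->
    D%:~R ^+ 2 <= x ->
    `| (\sum_(1 <= n < (Num.truncn x).+1 | (l %| n)%N) rep_count f n)%N%:R
       - 2 * pi / Num.sqrt D%:~R * g l * x |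
    <= C * ((num_divisors l)%:R * l%:R / (D%:~R `^ (1 / 6)) * x `^ (1 / 3)
            + (num_divisors l)%:R * l%:R `^ (5 / 2) * D%:~R `^ (3 / 4)
                / ((qa f)%:~R `^ (7 / 4)) * x `^ (1 / 4)).
Proof.
(* The coefficient of [class_count] plus 1, which pays for the term [n = 0]. *)
exists (37 + 32 * circle_const); split; first by have := circle_const_ge1 R; lra.
move=> f D l g x [prim pd /andP[ba ac] _] dD l1 sqf gM gp Dx.
have [dneg a0] := pd.
(* Reducedness gives [D = 4 a c - b ^ 2 >= 3 a ^ 2]. *)
have aD : qa f ^+ 2 <= D.
  have -> : D = 4 * qa f * qc f - qb f ^+ 2 by rewrite -[D]opprK -dD /disc; ring.
  have b2 : qb f ^+ 2 <= qa f ^+ 2.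
    by rewrite -[qb f ^+ 2]real_normK ?num_real // ler_pXn2r ?nnegrE // ltW.
  have c2 : qa f * qa f <= qa f * qc f by rewrite ler_pM2l.
  have a2 : 0 <= qa f * qa f by rewrite mulr_ge0 // ltW.
  rewrite !expr2 in b2 *; lra.
have aR1 : (1 : R) <= (qa f)%:~R by rewrite ler1z.
have aDR : (qa f)%:~R ^+ 2 <= D%:~R :> R by rewrite -rmorphXn /= ler_int.
have D1 : (1 : R) <= D%:~R by apply: le_trans aDR; rewrite exprn_ege1.
have Dlex : D%:~R <= x.
  by apply: le_trans Dx; rewrite expr2 ler_peMl //; lra.
rewrite -dD in gp.
have [ZE Zle] := zeros_mod_squarefree R f g l prim gM gp l1 sqf.
have cc := fun u v N ul vl => class_count R f D l x u v N pd dD aD l1 ul vl Dlex.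
move: cc; cbv zeta; set V := Num.sqrt (4 * _ * _ / _); set kappa := Num.sqrt _ / (2 * _).
set T := x `^ (1 / 3) / _; set Y := _ * x `^ (1 / 4).
set bound := V + _ + 3; set E := _ + 24 * Y => cc.
have T1 : 1 <= T by exact: main_term_ge1.
pose t := Num.truncn x.
(* The box must contain every lattice point with [f <= x], and also satisfy the size condition of
   the analytic count in each class. *)
pose N := maxn (Num.truncn bound).+1 (absz (4 * (qa f + qc f) * t%:Z)).+1.
have Nb : bound <= N%:R.
  apply: (@le_trans _ _ (Num.truncn bound).+1%:R); last by rewrite ler_nat leq_maxl.
  have [b0|b0] := leP 0 bound; first by have /andP[_ /ltW] := truncn_itv b0.
  by apply: (le_trans (ltW b0)).
have h : (absz (4 * (qa f + qc f) * t%:Z)%R < N)%N by rewrite leq_max ltnSn orbT.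
have N0 : (0 < N)%N by rewrite leq_max.
clearbody N.
have c0 : 0 < qc f by apply: lt_le_trans ac.
have Nt : 4 * (qa f + qc f) * t%:Z < (N * l)%N%:Z.
  have h2 : (N <= N * l)%N by rewrite leq_pmulr.
  by clear -h h2; lia.
have at_le : 4 * qa f * t%:Z < (N * l)%N%:Z.
  apply: le_lt_trans Nt; rewrite -subr_ge0.
  have -> : 4 * (qa f + qc f) * t%:Z - 4 * qa f * t%:Z = 4 * (qc f * t%:Z) by ring.
  by apply: mulr_ge0 => //; apply: mulr_ge0 => //; exact: ltW.
have ct_le : 4 * qc f * t%:Z < (N * l)%N%:Z.
  apply: le_lt_trans Nt; rewrite -subr_ge0.
  have -> : 4 * (qa f + qc f) * t%:Z - 4 * qc f * t%:Z = 4 * (qa f * t%:Z) by ring.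
  by apply: mulr_ge0 => //; apply: mulr_ge0 => //; exact: ltW.
have box u v : qeval f u v <= t%:Z ->
     (- (N * l)%N%:Z <= u < (N * l)%N%:Z) && (- (N * l)%N%:Z <= v < (N * l)%N%:Z).
  move=> /(qeval_box f _ u v pd)[hu hv].
  have Nl0 : 0 < (N * l)%N%:Z by rewrite ltz_nat muln_gt0 l1 andbT.
  by apply/andP; split; [exact: sqr_lt_itv ct_le hu|exact: sqr_lt_itv at_le hv].
have sumE := sum_rep_count f l t N pd l1 box.
set S := (\sum_(1 <= n < _ | _) _)%N in sumE *.
pose M0 := 2 * pi / Num.sqrt D%:~R * x / l%:R ^+ 2 : R.
have lR : (0 : R) < l%:R by rewrite ltr0n.
have lR1 : (1 : R) <= l%:R by rewrite (ler_nat _ 1).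
(* Every class has the same main term [M0], and the number of classes is [l ^ 2 g(l)]. *)
have mainE : 2 * pi / Num.sqrt D%:~R * g l * x = (zeros_mod f l)%:R * M0.
  rewrite ZE /M0; field; rewrite !lt0r_neq0 // ?sqrtr_gt0; lra.
have est : `|S.+1%:R - (zeros_mod f l)%:R * M0| <= (zeros_mod f l)%:R * E.
  rewrite sumE /zeros_mod !natr_sum !mulr_suml -sumrB.
  apply: (le_trans (ler_norm_sum _ _ _)); apply: ler_sum => u _.
  rewrite !natr_sum !mulr_suml -sumrB.
  apply: (le_trans (ler_norm_sum _ _ _)); apply: ler_sum => v _.
  rewrite natrM -mulrBr normrM ger0_norm // ler_wpM2l //.
  exact: (cc u v N (ltn_ord u) (ltn_ord v) Nb).
have E0 : 0 <= E.
  by have := cc 0%N 0%N N l1 l1 Nb; apply: le_trans; rewrite normr_ge0.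
have tau1 : (1 : R) <= (num_divisors l)%:R.
  rewrite (ler_nat _ 1) /num_divisors -has_predT; apply/hasP.
  by exists 1%N; rewrite // -dvdn_divisors.
have ZleR : (zeros_mod f l)%:R <= (num_divisors l)%:R * l%:R :> R by rewrite -natrM ler_nat.
have tl1 : 1 <= (num_divisors l)%:R * l%:R :> R by rewrite mulr_ege1.
have ZE_le := ler_wpM2r E0 ZleR.
have l52 : l%:R <= l%:R `^ (5 / 2) :> R.
  have h52 : 1 <= 5 / 2 :> R by clear; lra.
  by rewrite -[leLHS]powRr1 ?ler_powR // ltW.
have Y0 : 0 <= Y by rewrite /Y !mulr_ge0 ?invr_ge0 ?powR_ge0.
rewrite mainE.
have S1 : S%:R = S.+1%:R - 1 :> R by rewrite -natr1 addrK.
have -> : (num_divisors l)%:R * l%:R / (D%:~R `^ (1 / 6)) * x `^ (1 / 3)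
   = (num_divisors l)%:R * l%:R * T by rewrite /T; ring.
have -> : (num_divisors l)%:R * l%:R `^ (5 / 2) * D%:~R `^ (3 / 4)
                / ((qa f)%:~R `^ (7 / 4)) * x `^ (1 / 4)
   = (num_divisors l)%:R * (l%:R `^ (5 / 2) * Y) by rewrite /Y; ring.
have C1 := circle_const_ge1 R.
have k1 : 1 <= (num_divisors l)%:R * l%:R * T.
  by rewrite mulr_ege1.
have k2 : (num_divisors l)%:R * l%:R * Y <= (num_divisors l)%:R * (l%:R `^ (5 / 2) * Y).
  by rewrite -mulrA ler_wpM2l ?(le_trans ler01 tau1) // ler_wpM2r.
(* Removing [n = 0] costs 1, which is at most [tau(l) l T] since [T >= 1]. *)
have tri : `|S%:R - (zeros_mod f l)%:R * M0| <= (zeros_mod f l)%:R * E + 1.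
  rewrite S1 addrAC; apply: (le_trans (ler_normB _ _)).
  by rewrite normr1 lerD2r.
have k0 : 0 <= (num_divisors l)%:R * (l%:R `^ (5 / 2) * Y).
  by apply: mulr_ge0 => //; apply: mulr_ge0 => //; apply: powR_ge0.
apply: (le_trans tri); move: ZE_le k1 k2 k0 C1; rewrite /E.
move: (circle_const) => C0.
move: ((num_divisors l)%:R * (l%:R `^ (5 / 2) * Y)) => B.
move: ((num_divisors l)%:R * l%:R : R) => A.
move: (T) (Y) ((zeros_mod f l)%:R * _); clear=> T' Y' ZE' h1 h2 h3 h4 h5.
have h6 : 0 <= C0 * B by rewrite mulr_ge0 //; lra.
have h7 : A * (24 * Y') <= 24 * B by lra.
lra.
Qed.
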